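(* Let $x>0$ and let $\kappa,\mu$ be complex numbers with $\mathrm{Re}\left(\frac12+\mu-\kappa\right)>0$. Then $$\frac{\partial\,\mathrm{wi}_{\kappa,\mu}(x)}{\partial\kappa}=\frac{1}{\Gamma\left(\frac12+\mu-\kappa\right)}\int_0^\infty\left[\psi\left(\frac12+\mu-\kappa\right)+\ln\left(\frac{1+t}{t}\right)\right]\frac{t^{\mu-\kappa-1/2}(1+t)^{\mu+\kappa-1/2}}{\left(\frac12+t\right)^{\mu+1/2}}\,\Gamma\left(\frac12+\mu,\,x\left(t+\frac12\right)\right)dt.$$
   Context: The integral Whittaker function $\mathrm{wi}$ is $\mathrm{wi}_{\kappa,\mu}(x)=\int_x^\infty\frac{\mathrm{W}_{\kappa,\mu}(t)}{t}\,dt$, where for $t>0$ the Whittaker function is $\mathrm{W}_{\kappa,\mu}(t)=e^{-t/2}t^{\mu+1/2}\,\mathrm{U}\left(\frac12+\mu-\kappa,1+2\mu,t\right)$ with $\mathrm{U}$ the Tricomi confluent hypergeometric function. $\Gamma(\nu,z)=\int_z^\infty t^{\nu-1}e^{-t}\,dt$ is the upper incomplete gamma function, and $\psi=\Gamma'/\Gamma$ is the digamma function. *)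

(* Defs.v *)
(* Stdlib reals with Coquelicot. *)
From Stdlib Require Import Reals ClassicalEpsilon.
From Coquelicot Require Export Coquelicot.

Open Scope R_scope.

Definition Cexp (z : C) : C :=
  (exp (Re z) * cos (Im z), exp (Re z) * sin (Im z)).

(* Principal power of a positive real base: t^z = e^(z ln t), for t > 0. *)
Definition Rcpow (t : R) (z : C) : C := Cexp (z * RtoC (ln t))%C.

(* Complex-valued integrals of a real variable; the end points are filters, as
   in [is_RInt_gen].  Coquelicot declares no [CompleteNormedModule R_AbsRing]
   structure on [C], so the total operator is taken componentwise. *)
Definition ex_CInt_gen (f : R -> C) (Fa Fb : (R -> Prop) -> Prop) : Prop :=
  ex_RInt_gen (V := C_R_NormedModule) f Fa Fb.

Definition CInt_gen (f : R -> C) (Fa Fb : (R -> Prop) -> Prop) : C :=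
  (RInt_gen (fun t => Re (f t)) Fa Fb, RInt_gen (fun t => Im (f t)) Fa Fb).

(* Euler's integral, which defines Gamma on the half-plane Re z > 0 only. *)
Definition CGamma (z : C) : C :=
  CInt_gen (fun t => Rcpow t (z - 1) * RtoC (exp (- t)))%C
    (at_right 0) (Rbar_locally p_infty).

Definition digamma (z : C) : C := (C_derive CGamma z / CGamma z)%C.

(* Upper incomplete gamma function, for z > 0 and every complex nu. *)
Definition inc_Gamma (nu : C) (z : R) : C :=
  CInt_gen (fun t => Rcpow t (nu - 1) * RtoC (exp (- t)))%C
    (at_point z) (Rbar_locally p_infty).

(* Tricomi's function U(a,b,.) on the positive axis, for all complex a and b:
   the solution of Kummer's equation t w'' + (b - t) w' - a w = 0 such that
   w(t) ~ t^(-a) as t -> +oo.  This determines w on (0,+oo), since a solution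
   that is not a multiple of U(a,b,.) is of exact order e^t t^(a-b) at +oo. *)
Definition is_tricomi (a b : C) (w : R -> C) : Prop :=
  (exists w1 w2 : R -> C,
    forall t : R, 0 < t ->
      is_derive (V := C_R_NormedModule) w t (w1 t) /\
      is_derive (V := C_R_NormedModule) w1 t (w2 t) /\
      (RtoC t * w2 t + (b - RtoC t) * w1 t - a * w t = 0)%C) /\
  filterlim (fun t => Rcpow t a * w t)%C
    (Rbar_locally p_infty) (locally (RtoC 1)).

(* Only the values at t > 0 are meaningful. *)
Definition tricomiU (a b : C) : R -> C :=
  epsilon (inhabits (fun _ : R => RtoC 0)) (is_tricomi a b).

Definition whittakerW (kappa mu : C) (t : R) : C :=
  (RtoC (exp (- t / 2)) * Rcpow t (mu + / 2)
   * tricomiU (/ 2 + mu - kappa) (1 + 2 * mu) t)%C.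

Definition wi (kappa mu : C) (x : R) : C :=
  CInt_gen (fun t => whittakerW kappa mu t / RtoC t)%C
    (at_point x) (Rbar_locally p_infty).

(* Main.v *)
Require Import Defs.
From Stdlib Require Import Reals Lra ClassicalEpsilon.
From Coquelicot Require Import Coquelicot.
Open Scope R_scope.

(** For [Re a > 0], [U(a, b, t)] is [1 / Gamma(a)] times
    [int_0^oo e^(-ts) s^(a-1) (1+s)^(b-a-1) ds]: this integral solves Kummer's equation and has the
    right behaviour at [+oo], and Abel's identity for the Wronskian shows that nothing else does.
    As a function of [x], the integral of [s^(a-1) (1+s)^(b-a-1) (s+1/2)^(-nu) Gamma(nu, x(s+1/2))],
    with [nu = mu + 1/2], tends to [0] at [+oo] and has derivative [-Gamma(a) W(x)/x], so that it equals
    [Gamma(a) wi(x)]; this replaces an exchange of two integrals.  In [kappa] its integrand is an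
    exponential, so it can be differentiated under the integral sign, and the digamma term comes
    from the factor [1 / Gamma(a)].

    Every differentiation under the integral sign rests on a pointwise bound
    [|f(z+h) - f(z) - h f'(z)| <= |h|^2 g] with [g] integrable: no convergence theorem is needed. *)

(** * Improper integrals of complex-valued functions *)

(** [CGamma] is only Euler's integral on the right half-plane, so neither a reflection formula nor a
    product is at hand, yet every quotient by [CGamma a] needs it to be nonzero. A zero is pushed to
    the right by [Gamma(z + 1) = z Gamma(z)] until the phase of the integrand hardly varies where
    its mass lies. [tricomiU] is a choice among functions, so a formula for it requires existence
    and uniqueness; uniqueness has to rest on the asymptotics of the solutions alone, since nothing
    is assumed about their derivatives at infinity. Most integrals over (0, +oo) are compared with
    one family, [s^(p-1) (1+s)^q e^(-c s)], whose three parameters leave room to absorb logarithms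
    and small powers. [CInt_gen] is total, so integrals are handled through a relation that also
    asserts convergence. *)

Lemma ex_RInt_gen_dominated (f g : R -> R) (Fa Fb : (R -> Prop) -> Prop)
    {FFa : ProperFilter Fa} {FFb : ProperFilter Fb} :
  filter_prod Fa Fb (fun ab => fst ab <= snd ab /\
    forall t, fst ab <= t <= snd ab -> continuous f t /\ Rabs (f t) <= g t) ->
  ex_RInt_gen g Fa Fb -> ex_RInt_gen f Fa Fb.
Proof.
  intros Hdom [I HI].
  assert (Hex : forall a b : R, a <= b ->
    (forall t, a <= t <= b -> continuous f t /\ Rabs (f t) <= g t) -> ex_RInt f a b).
  { intros a b Hab H. apply (ex_RInt_continuous (V := R_CompleteNormedModule)).
    rewrite Rmin_left, Rmax_right by lra. intros z Hz. now apply H. }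
  unfold ex_RInt_gen, is_RInt_gen.
  apply (filterlimi_locally_cauchy (U := R_CompleteSpace)
           (F := filter_prod Fa Fb) (fun ab => is_RInt f (fst ab) (snd ab))).
  - eapply filter_imp; [|exact Hdom]. intros [a b] [Hab H]; simpl in *. split.
    + destruct (Hex a b Hab H) as [l Hl]. now exists l.
    + intros y1 y2 H1 H2.
      apply (is_RInt_unique (V := R_CompleteNormedModule)) in H1.
      apply (is_RInt_unique (V := R_CompleteNormedModule)) in H2.
      congruence.
  - intros eps.
    (* Two admissible intervals differ by one piece at each end. Each piece is bounded by the
       matching integral of [g], a difference of two values within [eps / 8] of [I]; the two pieces
       together cost at most [eps / 2]. *)
    assert (He4 : 0 < eps / 8) by (destruct eps; simpl; lra).
    pose proof (proj1 (filterlimi_locally (F := filter_prod Fa Fb)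
       (fun ab => is_RInt g (fst ab) (snd ab)) I) HI (mkposreal _ He4)) as HI'.
    pose proof (filter_and _ _ Hdom HI') as Hboth.
    destruct Hboth as [A B HA HB HAB]. simpl in HAB.
    exists (fun ab => A (fst ab) /\ B (snd ab)). split.
    { exists A B; auto. }
    intros [a b] [a' b'] [Ha Hb] [Ha' Hb'] y y' Hy Hy'; simpl in *.
    assert (Hg : forall u v, A u -> B v -> exists z, is_RInt g u v z /\ Rabs (z - I) < eps / 8).
    { intros u v Hu Hv. destruct (HAB u v Hu Hv) as [_ [z [Hz1 Hz2]]].
      exists z. split; [exact Hz1|]. exact Hz2. }
    (* The intervals that start at [u] and at [v] share the end [w], so the integral of [g] over
       [u, v] is a difference of two integrals close to [I]. *)
    assert (HgA : forall u v w, A u -> A v -> B w -> u <= v ->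
              exists z, is_RInt f u v z /\ Rabs z <= eps / 4).
    { intros u v w Hu Hv Hw Huv.
      destruct (HAB u w Hu Hw) as [[Huw Hd] _]. destruct (HAB v w Hv Hw) as [[Hvw _] _].
      destruct (Hg u w Hu Hw) as [z1 [Hz1 Hz1']]. destruct (Hg v w Hv Hw) as [z2 [Hz2 Hz2']].
      assert (Hgz : is_RInt g u v (plus z1 (opp z2))).
      { apply (is_RInt_Chasles _ u w v); [exact Hz1|].
        now apply is_RInt_swap. }
      destruct (Hex u v Huv) as [z Hz].
      { intros t Ht. apply Hd. lra. }
      exists z. split; [exact Hz|].
      apply Rle_trans with (plus z1 (opp z2)).
      - change (norm z <= plus z1 (opp z2)).
        apply (norm_RInt_le f g u v); auto. intros t Ht. apply (Hd t). lra.
      - unfold plus, opp; simpl. apply Rabs_def2 in Hz1'. apply Rabs_def2 in Hz2'. lra. }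
    assert (HgB : forall u v w, B u -> B v -> A w -> u <= v ->
              exists z, is_RInt f u v z /\ Rabs z <= eps / 4).
    { intros u v w Hu Hv Hw Huv.
      destruct (HAB w v Hw Hv) as [[Hwv Hd] _]. destruct (HAB w u Hw Hu) as [[Hwu _] _].
      destruct (Hg w u Hw Hu) as [z1 [Hz1 Hz1']]. destruct (Hg w v Hw Hv) as [z2 [Hz2 Hz2']].
      assert (Hgz : is_RInt g u v (plus (opp z1) z2)).
      { apply (is_RInt_Chasles _ u w v); [|exact Hz2].
        now apply is_RInt_swap. }
      destruct (Hex u v Huv) as [z Hz].
      { intros t Ht. apply Hd. lra. }
      exists z. split; [exact Hz|].
      apply Rle_trans with (plus (opp z1) z2).
      - change (norm z <= plus (opp z1) z2).
        apply (norm_RInt_le f g u v); auto. intros t Ht. apply (Hd t). lra.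
      - unfold plus, opp; simpl. apply Rabs_def2 in Hz1'. apply Rabs_def2 in Hz2'. lra. }
    assert (HA2 : exists z, is_RInt f a a' z /\ Rabs z <= eps / 4).
    { destruct (Rle_or_lt a a') as [h|h].
      - now apply (HgA a a' b).
      - destruct (HgA a' a b) as [z [Hz1 Hz2]]; auto; [lra|].
        exists (opp z). split; [now apply is_RInt_swap|].
        unfold opp; simpl. now rewrite Rabs_Ropp. }
    assert (HB2 : exists z, is_RInt f b' b z /\ Rabs z <= eps / 4).
    { destruct (Rle_or_lt b' b) as [h|h].
      - now apply (HgB b' b a).
      - destruct (HgB b b' a) as [z [Hz1 Hz2]]; auto; [lra|].
        exists (opp z). split; [now apply is_RInt_swap|].
        unfold opp; simpl. now rewrite Rabs_Ropp. }
    destruct HA2 as [z1 [Hz1 Hz1']]. destruct HB2 as [z2 [Hz2 Hz2']].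
    assert (Hy2 : is_RInt f a b (plus (plus z1 y') z2)).
    { apply (is_RInt_Chasles _ a b' b); [|exact Hz2].
      now apply (is_RInt_Chasles _ a a' b'). }
    apply (is_RInt_unique (V := R_CompleteNormedModule)) in Hy.
    apply (is_RInt_unique (V := R_CompleteNormedModule)) in Hy2.
    assert (E : y = plus (plus z1 y') z2) by congruence.
    change (Rabs (y' - y) < eps).
    rewrite E. unfold plus; simpl.
    replace (y' - (z1 + y' + z2)) with (- (z1 + z2)) by ring.
    rewrite Rabs_Ropp. pose proof (Rabs_triang z1 z2). destruct eps; simpl in *; lra.
Qed.

(** Componentwise, to match [CInt_gen], but a relation: it asserts the convergence that the total
    operator hides. *)
Definition is_CInt_gen (f : R -> C) (Fa Fb : (R -> Prop) -> Prop) (l : C) : Prop :=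
  is_RInt_gen (fun t => Re (f t)) Fa Fb (Re l) /\
  is_RInt_gen (fun t => Im (f t)) Fa Fb (Im l).

Definition ccontinuous (f : R -> C) (t : R) : Prop :=
  continuous (fun t => Re (f t)) t /\ continuous (fun t => Im (f t)) t.

(* The bound [m] makes [a <= b] hold eventually when [b] tends to [+oo]. *)
Definition starts_in (Fa : (R -> Prop) -> Prop) (D : R -> Prop) : Prop :=
  exists m : R, Fa (fun a => a <= m /\ forall t, a <= t -> D t).

Local Notation pinfty := (Rbar_locally p_infty) (only parsing).

Lemma starts_in_right0 : starts_in (at_right 0) (fun t => 0 < t).
Proof.
  exists 1. exists (mkposreal 1 Rlt_0_1). intros y Hy Hy0.
  assert (H := Hy). unfold ball in H; simpl in H; unfold AbsRing_ball in H.
  unfold abs, minus, plus, opp in H; simpl in H. apply Rabs_def2 in H.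
  split; [lra|]. intros t Ht. lra.
Qed.

Lemma starts_in_point (z : R) (D : R -> Prop) :
  (forall t, z <= t -> D t) -> starts_in (at_point z) D.
Proof. intros H. exists z. split; [lra | exact H]. Qed.

Lemma starts_in_prod (Fa : (R -> Prop) -> Prop) {FFa : Filter Fa} (D : R -> Prop) :
  starts_in Fa D ->
  filter_prod Fa pinfty (fun ab => fst ab <= snd ab /\ forall t, fst ab <= t -> D t).
Proof.
  intros [m Hm]. eexists; [exact Hm | exists m; intros x Hx; exact Hx |].
  intros a b [Ha H] Hb; simpl in *. split; [lra|assumption].
Qed.

Lemma is_CInt_gen_unique (f : R -> C) Fa Fb {FFa : ProperFilter' Fa}
    {FFb : ProperFilter' Fb} (l : C) :
  is_CInt_gen f Fa Fb l -> CInt_gen f Fa Fb = l.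
Proof.
  intros [H1 H2]. unfold CInt_gen.
  rewrite (is_RInt_gen_unique (V := R_CompleteNormedModule) _ _ H1).
  rewrite (is_RInt_gen_unique (V := R_CompleteNormedModule) _ _ H2).
  now destruct l.
Qed.

Lemma is_CInt_gen_ext Fa {FFa : Filter Fa} (D : R -> Prop) (f g : R -> C) (l : C) :
  starts_in Fa D -> (forall t, D t -> f t = g t) ->
  is_CInt_gen f Fa pinfty l -> is_CInt_gen g Fa pinfty l.
Proof.
  intros HD Hfg [H1 H2].
  split; [eapply is_RInt_gen_ext; [|exact H1] | eapply is_RInt_gen_ext; [|exact H2]];
  (eapply filter_imp; [|exact (starts_in_prod Fa D HD)]; intros [a b] [Hab HDt]; simpl in *;
   intros t Ht; rewrite Rmin_left in Ht by lra; rewrite Hfg; [reflexivity | apply HDt; lra]).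
Qed.

Lemma is_CInt_gen_plus Fa Fb {FFa : Filter Fa} {FFb : Filter Fb}
    (f g : R -> C) (l1 l2 : C) :
  is_CInt_gen f Fa Fb l1 -> is_CInt_gen g Fa Fb l2 ->
  is_CInt_gen (fun t => f t + g t)%C Fa Fb (l1 + l2)%C.
Proof.
  intros [H1 H2] [H3 H4]. split.
  - exact (is_RInt_gen_plus _ _ _ _ H1 H3).
  - exact (is_RInt_gen_plus _ _ _ _ H2 H4).
Qed.

Lemma is_CInt_gen_scal Fa Fb {FFa : Filter Fa} {FFb : Filter Fb}
    (f : R -> C) (k l : C) :
  is_CInt_gen f Fa Fb l -> is_CInt_gen (fun t => k * f t)%C Fa Fb (k * l)%C.
Proof.
  intros [H1 H2]. split.
  - exact (is_RInt_gen_minus _ _ _ _ (is_RInt_gen_scal _ (Re k) _ H1)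
             (is_RInt_gen_scal _ (Im k) _ H2)).
  - exact (is_RInt_gen_plus _ _ _ _ (is_RInt_gen_scal _ (Re k) _ H2)
             (is_RInt_gen_scal _ (Im k) _ H1)).
Qed.

Lemma is_CInt_gen_minus Fa Fb {FFa : Filter Fa} {FFb : Filter Fb}
    (f g : R -> C) (l1 l2 : C) :
  is_CInt_gen f Fa Fb l1 -> is_CInt_gen g Fa Fb l2 ->
  is_CInt_gen (fun t => f t - g t)%C Fa Fb (l1 - l2)%C.
Proof.
  intros [H1 H2] [H3 H4]. split.
  - exact (is_RInt_gen_minus _ _ _ _ H1 H3).
  - exact (is_RInt_gen_minus _ _ _ _ H2 H4).
Qed.

Lemma im_le_Cmod (z : C) : Rabs (Im z) <= Cmod z.
Proof.
  eapply Rle_trans; [|apply Rmax_Cmod]. apply Rmax_r.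
Qed.

Lemma Cmod_le_Rabs (z : C) : Cmod z <= Rabs (Re z) + Rabs (Im z).
Proof.
  apply Rsqr_incr_0_var.
  - unfold Cmod. unfold Rsqr. rewrite sqrt_sqrt.
    + rewrite <- (pow2_abs (fst z)), <- (pow2_abs (snd z)). unfold Re, Im.
      pose proof (Rabs_pos (fst z)). pose proof (Rabs_pos (snd z)). nra.
    + nra.
  - pose proof (Rabs_pos (Re z)). pose proof (Rabs_pos (Im z)). lra.
Qed.

Lemma is_CInt_gen_dominated Fa {FFa : ProperFilter Fa} (D : R -> Prop)
    (f : R -> C) (g : R -> R) :
  starts_in Fa D -> (forall t, D t -> ccontinuous f t) ->
  (forall t, D t -> Cmod (f t) <= g t) -> ex_RInt_gen g Fa pinfty ->
  is_CInt_gen f Fa pinfty (CInt_gen f Fa pinfty).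
Proof.
  intros HD Hc Hle Hg.
  split; apply (RInt_gen_correct (V := R_CompleteNormedModule));
  (apply ex_RInt_gen_dominated with g; auto;
   [apply Rbar_locally_filter|];
   eapply filter_imp; [|exact (starts_in_prod Fa D HD)]; intros [a b] [Hab HDt]; simpl in *;
   split; [assumption|]; intros t Ht; assert (D t) by (apply HDt; lra); split;
   [apply Hc; auto | ]).
  - eapply Rle_trans; [apply re_le_Cmod | auto].
  - eapply Rle_trans; [apply im_le_Cmod | auto].
Qed.

(** The real and the imaginary part are each bounded by [lg]; hence the factor 2, which reappears in
    later estimates. *)
Lemma is_CInt_gen_Cmod_le Fa {FFa : ProperFilter Fa} (D : R -> Prop)
    (f : R -> C) (g : R -> R) (l : C) (lg : R) :
  starts_in Fa D ->
  (forall t, D t -> Cmod (f t) <= g t) ->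
  is_CInt_gen f Fa pinfty l -> is_RInt_gen g Fa pinfty lg -> Cmod l <= 2 * lg.
Proof.
  intros HD Hle [H1 H2] Hg.
  assert (Hk : forall (h : R -> R) (lh : R), (forall t, D t -> Rabs (h t) <= g t) ->
     is_RInt_gen h Fa pinfty lh -> Rabs lh <= lg).
  { intros h lh Hh Hih.
    apply (RInt_gen_norm (V := R_CompleteNormedModule) (Fa := Fa) (Fb := pinfty) h g lh lg); auto.
    - eapply filter_imp; [|exact (starts_in_prod Fa D HD)]. now intros [a b] [Hab HDt].
    - eapply filter_imp; [|exact (starts_in_prod Fa D HD)]. intros [a b] [Hab HDt]; simpl in *.
      intros t Ht. apply Hh. apply HDt. lra. }
  eapply Rle_trans; [apply Cmod_le_Rabs|].
  assert (Rabs (Re l) <= lg).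
  { eapply Hk; [|exact H1]. intros t Ht. eapply Rle_trans; [apply re_le_Cmod | auto]. }
  assert (Rabs (Im l) <= lg).
  { eapply Hk; [|exact H2]. intros t Ht. eapply Rle_trans; [apply im_le_Cmod | auto]. }
  lra.
Qed.

Lemma is_CInt_gen_ex (f : R -> C) Fa Fb {FFa : Filter Fa} {FFb : Filter Fb} (l : C) :
  is_CInt_gen f Fa Fb l -> ex_CInt_gen f Fa Fb.
Proof.
  intros [H1 H2]. exists l.
  apply filterlimi_locally. intros eps.
  pose proof (proj1 (filterlimi_locally (F := filter_prod Fa Fb) _ _) H1 eps) as K1.
  pose proof (proj1 (filterlimi_locally (F := filter_prod Fa Fb) _ _) H2 eps) as K2.
  eapply filter_imp; [|exact (filter_and _ _ K1 K2)].
  intros [a b] [[z1 [Hz1 Hb1]] [z2 [Hz2 Hb2]]]. simpl in *.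
  exists (z1, z2). split.
  - now apply (is_RInt_fct_extend_pair (U := R_NormedModule) (V := R_NormedModule) f).
  - split; assumption.
Qed.

(** Componentwise, so that the real derivative rules and [auto_derive] apply. *)
Definition is_cderive (f : R -> C) (t : R) (l : C) : Prop :=
  is_derive (fun t => Re (f t)) t (Re l) /\ is_derive (fun t => Im (f t)) t (Im l).

Lemma is_cderive_continuous (f : R -> C) (t : R) (l : C) :
  is_cderive f t l -> ccontinuous f t.
Proof.
  intros [H1 H2]. split; apply (ex_derive_continuous (V := R_NormedModule)); eexists; eassumption.
Qed.

(** Stated with [Cmod], as the estimates are, because the balls of the uniform structure on [C] are
    products of real balls; [is_climit_filterlim] compares the two. *)
Definition is_climit (f : R -> C) (F : (R -> Prop) -> Prop) (l : C) : Prop :=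
  forall eps : posreal, F (fun t => Cmod (f t - l)%C < eps).

Lemma is_climit_parts (f : R -> C) (F : (R -> Prop) -> Prop) {FF : Filter F} (l : C) :
  is_climit f F l ->
  filterlim (fun t => Re (f t)) F (locally (Re l)) /\
  filterlim (fun t => Im (f t)) F (locally (Im l)).
Proof.
  intros H. split; apply filterlim_locally; intros eps; (eapply filter_imp; [|exact (H eps)]);
  intros t Ht; (eapply Rle_lt_trans; [|exact Ht]).
  - exact (re_le_Cmod (f t - l)%C).
  - exact (im_le_Cmod (f t - l)%C).
Qed.

(** The fundamental theorem on an unbounded interval. The lower end is a filter, so that it serves
    both [at_right 0] and [at_point x]. *)
Lemma is_CInt_gen_derive Fa {FFa : ProperFilter Fa} (F f : R -> C) (la lb : C) :
  starts_in Fa (fun t => 0 < t) ->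
  (forall t, 0 < t -> is_cderive F t (f t)) ->
  (forall t, 0 < t -> ccontinuous f t) ->
  is_climit F Fa la -> is_climit F pinfty lb ->
  is_CInt_gen f Fa pinfty (lb - la)%C.
Proof.
  intros HD Hd Hc Ha Hb.
  assert (K : forall (G g : R -> R) (ga gb : R),
    (forall t, 0 < t -> is_derive G t (g t)) ->
    (forall t, 0 < t -> continuous g t) ->
    filterlim G Fa (locally ga) -> filterlim G pinfty (locally gb) ->
    is_RInt_gen g Fa pinfty (gb - ga)).
  { intros G g ga gb HG Hg Hga Hgb.
    apply is_RInt_gen_ext with (Derive G).
    { eapply filter_imp; [|exact (starts_in_prod Fa _ HD)]. intros [a b] [Hab HDt]; simpl in *.
      intros t Ht. rewrite Rmin_left in Ht by lra. apply is_derive_unique. apply HG.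
      apply HDt. lra. }
    apply is_RInt_gen_Derive; auto; try apply Rbar_locally_filter.
    - eapply filter_imp; [|exact (starts_in_prod Fa _ HD)]. intros [a b] [Hab HDt]; simpl in *.
      intros t Ht. rewrite Rmin_left in Ht by lra. exists (g t). apply HG.
      apply HDt. lra.
    - eapply filter_imp; [|exact (starts_in_prod Fa _ HD)]. intros [a b] [Hab HDt]; simpl in *.
      intros t Ht. rewrite Rmin_left in Ht by lra.
      assert (Ht0 : 0 < t) by (apply HDt; lra).
      (* [Derive G] is continuous at [t] because it agrees with [g] on the neighbourhood (0, 2t). *)
      refine (continuous_ext_loc (Derive G) g t _ (Hg t Ht0)).
      exists (mkposreal t Ht0). intros y Hy. unfold ball in Hy; simpl in Hy.
      unfold AbsRing_ball, abs, minus, plus, opp in Hy; simpl in Hy. apply Rabs_def2 in Hy.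
      symmetry. apply is_derive_unique. apply HG. lra. }
  destruct (is_climit_parts F Fa la Ha) as [Ha1 Ha2].
  destruct (is_climit_parts F pinfty lb Hb) as [Hb1 Hb2].
  split.
  - apply (K (fun t => Re (F t))); auto; intros t Ht; [apply (Hd t Ht) | apply (Hc t Ht)].
  - apply (K (fun t => Im (F t))); auto; intros t Ht; [apply (Hd t Ht) | apply (Hc t Ht)].
Qed.

(** * Calculus of complex-valued functions of a real variable *)

Lemma is_derive_Rmult (f g : R -> R) (t df dg : R) :
  is_derive f t df -> is_derive g t dg ->
  is_derive (fun t => f t * g t) t (df * g t + f t * dg).
Proof.
  intros Hf Hg. apply (is_derive_mult f g t df dg Hf Hg).
  intros n m. apply Rmult_comm.
Qed.

Lemma is_derive_value (f : R -> R) (t l l' : R) : is_derive f t l -> l = l' -> is_derive f t l'.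
Proof. now intros H <-. Qed.

Lemma is_cderive_value (f : R -> C) (t : R) (l l' : C) :
  is_cderive f t l -> l = l' -> is_cderive f t l'.
Proof. now intros H <-. Qed.

Lemma is_cderive_ext (f g : R -> C) (t : R) (l : C) :
  (forall s, f s = g s) -> is_cderive f t l -> is_cderive g t l.
Proof.
  intros H [H1 H2]. split; (eapply is_derive_ext; [|eassumption]); intros s; simpl; now rewrite H.
Qed.

Lemma locally_pos (t : R) : 0 < t -> locally t (fun s => 0 < s).
Proof.
  intros Ht. exists (mkposreal t Ht). intros y Hy. unfold ball in Hy; simpl in Hy.
  unfold AbsRing_ball, abs, minus, plus, opp in Hy; simpl in Hy. apply Rabs_def2 in Hy. lra.
Qed.

Lemma is_cderive_const (k : C) (t : R) : is_cderive (fun _ => k) t 0%C.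
Proof.
  split; [exact (is_derive_const (V := R_NormedModule) (Re k) t)
         | exact (is_derive_const (V := R_NormedModule) (Im k) t)].
Qed.

Lemma is_cderive_RtoC (f : R -> R) (t l : R) :
  is_derive f t l -> is_cderive (fun t => RtoC (f t)) t (RtoC l).
Proof. intros H. split; [exact H | exact (is_derive_const (V := R_NormedModule) 0 t)]. Qed.

Lemma is_cderive_minus (f g : R -> C) (t : R) (lf lg : C) :
  is_cderive f t lf -> is_cderive g t lg ->
  is_cderive (fun t => f t - g t)%C t (lf - lg)%C.
Proof.
  intros [H1 H2] [H3 H4]. split.
  - exact (is_derive_minus _ _ _ _ _ H1 H3).
  - exact (is_derive_minus _ _ _ _ _ H2 H4).
Qed.

Lemma is_cderive_mult (f g : R -> C) (t : R) (lf lg : C) :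
  is_cderive f t lf -> is_cderive g t lg ->
  is_cderive (fun t => f t * g t)%C t (lf * g t + f t * lg)%C.
Proof.
  intros [H1 H2] [H3 H4]. split.
  - eapply is_derive_value.
    + exact (is_derive_minus _ _ _ _ _ (is_derive_Rmult _ _ _ _ _ H1 H3)
               (is_derive_Rmult _ _ _ _ _ H2 H4)).
    + unfold minus, plus, opp; simpl. unfold Re, Im. ring.
  - eapply is_derive_value.
    + exact (is_derive_plus _ _ _ _ _ (is_derive_Rmult _ _ _ _ _ H1 H4)
               (is_derive_Rmult _ _ _ _ _ H2 H3)).
    + unfold minus, plus, opp; simpl. unfold Re, Im. ring.
Qed.

Lemma is_cderive_scal (k : C) (g : R -> C) (t : R) (l : C) :
  is_cderive g t l -> is_cderive (fun t => k * g t)%C t (k * l)%C.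
Proof.
  intros H. eapply is_cderive_value.
  - apply (is_cderive_mult _ _ _ _ _ (is_cderive_const k t) H).
  - ring.
Qed.

Lemma is_cderive_comp (f : R -> C) (g : R -> R) (t : R) (lf : C) (lg : R) :
  is_cderive f (g t) lf -> is_derive g t lg ->
  is_cderive (fun t => f (g t)) t (RtoC lg * lf)%C.
Proof.
  intros [H1 H2] Hg. split.
  - eapply is_derive_value; [exact (is_derive_comp _ _ _ _ _ H1 Hg)|].
    unfold scal; simpl; unfold mult; simpl. unfold Re. ring.
  - eapply is_derive_value; [exact (is_derive_comp _ _ _ _ _ H2 Hg)|].
    unfold scal; simpl; unfold mult; simpl. unfold Im. ring.
Qed.

(** Needed to enter and leave [is_tricomi], which is stated with the derivative of the normed
    module. *)
Lemma is_cderive_is_derive (f : R -> C) (t : R) (l : C) :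
  is_cderive f t l <-> is_derive (V := C_R_NormedModule) f t l.
Proof.
  split.
  - intros [H1 H2]. split.
    { apply is_linear_scal_l. }
    intros x Hx. apply (is_filter_lim_locally_unique (V := AbsRing_NormedModule R_AbsRing)) in Hx. subst x.
    intros eps.
    destruct H1 as [_ H1]. destruct H2 as [_ H2].
    assert (He : 0 < eps / 2) by (destruct eps; simpl; lra).
    specialize (H1 t (fun P HP => HP) (mkposreal _ He)).
    specialize (H2 t (fun P HP => HP) (mkposreal _ He)).
    eapply filter_imp; [|exact (filter_and _ _ H1 H2)].
    intros y [K1 K2]. rewrite <- Cmod_norm.
    eapply Rle_trans; [apply Cmod_le_Rabs|].
    unfold norm, minus, plus, opp, scal, mult, abs in *; simpl in *.
    unfold mult, abs in *; simpl in *. unfold Re, Im in *; simpl in *.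
    change (Rabs (fst (f y) + - fst (f t) + - ((y + - t) * fst l)) +
      Rabs (snd (f y) + - snd (f t) + - ((y + - t) * snd l)) <= eps * Rabs (y + - t)). lra.
  - intros [_ H]. specialize (H t (fun P HP => HP)).
    split; (split; [apply is_linear_scal_l|]);
    intros x Hx;
    apply (is_filter_lim_locally_unique (V := AbsRing_NormedModule R_AbsRing)) in Hx;
    subst x; intros eps;
    (eapply filter_imp; [|exact (H eps)]); intros y K;
    (eapply Rle_trans; [|exact K]).
    + eapply Rle_trans; [|right; apply Cmod_norm].
      exact (re_le_Cmod (minus (G := C_R_NormedModule) (minus (G := C_R_NormedModule) (f y) (f t))
        (scal (V := C_R_NormedModule) (minus (G := R_AbelianGroup) y t) l))).
    + eapply Rle_trans; [|right; apply Cmod_norm].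
      exact (im_le_Cmod (minus (G := C_R_NormedModule) (minus (G := C_R_NormedModule) (f y) (f t))
        (scal (V := C_R_NormedModule) (minus (G := R_AbelianGroup) y t) l))).
Qed.

Lemma ccontinuous_mult (f g : R -> C) (t : R) :
  ccontinuous f t -> ccontinuous g t -> ccontinuous (fun t => f t * g t)%C t.
Proof.
  intros [H1 H2] [H3 H4]. split.
  - exact (continuous_minus _ _ _ (continuous_mult _ _ _ H1 H3) (continuous_mult _ _ _ H2 H4)).
  - exact (continuous_plus _ _ _ (continuous_mult _ _ _ H1 H4) (continuous_mult _ _ _ H2 H3)).
Qed.

(** The mean value theorem, twice: the increment of [f] is [h f1(c)], and [f1(c) - f1(x)] is
    [(c - x) f2(d)] with [|c - x| <= |h|]. The sharp factor 1/2 is not sought. *)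
Lemma is_derive_taylor2 (f f1 f2 : R -> R) (x h M : R) :
  (forall y, Rabs (y - x) <= Rabs h ->
    is_derive f y (f1 y) /\ is_derive f1 y (f2 y) /\ Rabs (f2 y) <= M) ->
  Rabs (f (x + h) - f x - h * f1 x) <= M * (h * h).
Proof.
  intros H.
  assert (Hb : forall u v w, Rmin x u <= v <= Rmax x u -> Rmin x v <= w <= Rmax x v ->
     Rabs (w - x) <= Rabs (v - x) <= Rabs (u - x)).
  { intros u v w. unfold Rmin, Rmax. do 2 destruct Rle_dec; intros; split;
      unfold Rabs; repeat destruct Rcase_abs; lra. }
  destruct (MVT_gen f x (x + h) f1) as [c [Hc Ec]].
  - intros y Hy. apply (H y).
    destruct (Hb (x + h) y y) as [_ K]; [lra | split; [apply Rmin_r | apply Rmax_r]|].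
    now replace (x + h - x) with h in K by ring.
  - intros y Hy. apply derivable_continuous_pt. exists (f1 y). apply is_derive_Reals. apply (H y).
    destruct (Hb (x + h) y y) as [_ K]; [lra | split; [apply Rmin_r | apply Rmax_r]|].
    now replace (x + h - x) with h in K by ring.
  - destruct (Hb (x + h) c c) as [_ K0]; [lra | split; [apply Rmin_r | apply Rmax_r]|].
    replace (x + h - x) with h in * by ring.
    destruct (MVT_gen f1 x c f2) as [d [Hd Ed]].
    + intros y Hy. apply (H y). destruct (Hb (x + h) c y); [lra|lra|].
      replace (x + h - x) with h in * by ring. lra.
    + intros y Hy. apply derivable_continuous_pt. exists (f2 y). apply is_derive_Reals. apply (H y).
      destruct (Hb (x + h) c y); [lra|lra|]. replace (x + h - x) with h in * by ring. lra.
    + destruct (Hb (x + h) c d) as [K1 K2]; [lra|lra|]. replace (x + h - x) with h in * by ring.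
      rewrite Ec. replace (f1 c * h - h * f1 x) with (h * (f1 c - f1 x)) by ring.
      rewrite Ed, !Rabs_mult.
      destruct (H d ltac:(lra)) as [_ [_ Hd2]].
      replace (M * (h * h)) with (Rabs h * (M * Rabs h)).
      2:{ rewrite <- (Rabs_pos_eq (h * h)), Rabs_mult by nra. ring. }
      pose proof (Rabs_pos h). pose proof (Rabs_pos (f2 d)). pose proof (Rabs_pos (c - x)).
      apply Rmult_le_compat_l; [lra|]. apply Rmult_le_compat; lra.
Qed.

Lemma is_cderive_taylor2 (f f1 f2 : R -> C) (x h M : R) :
  (forall y, Rabs (y - x) <= Rabs h ->
    is_cderive f y (f1 y) /\ is_cderive f1 y (f2 y) /\ Cmod (f2 y) <= M) ->
  Cmod (f (x + h)%R - f x - RtoC h * f1 x)%C <= 2 * M * (h * h).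
Proof.
  intros H. eapply Rle_trans; [apply Cmod_le_Rabs|].
  assert (Rabs (Re (f (x + h)%R) - Re (f x) - h * Re (f1 x)) <= M * (h * h)).
  { apply (is_derive_taylor2 (fun t => Re (f t)) (fun t => Re (f1 t)) (fun t => Re (f2 t))).
    intros y Hy. destruct (H y Hy) as [[H1 _] [[H2 _] H3]]. split; [exact H1|]. split; [exact H2|].
    eapply Rle_trans; [apply re_le_Cmod|exact H3]. }
  assert (Rabs (Im (f (x + h)%R) - Im (f x) - h * Im (f1 x)) <= M * (h * h)).
  { apply (is_derive_taylor2 (fun t => Im (f t)) (fun t => Im (f1 t)) (fun t => Im (f2 t))).
    intros y Hy. destruct (H y Hy) as [[_ H1] [[_ H2] H3]]. split; [exact H1|]. split; [exact H2|].
    eapply Rle_trans; [apply im_le_Cmod|exact H3]. }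
  replace (Re _) with (Re (f (x + h)%R) - Re (f x) - h * Re (f1 x)) by (simpl; unfold Re; ring).
  replace (Im _) with (Im (f (x + h)%R) - Im (f x) - h * Im (f1 x)) by (simpl; unfold Im; ring).
  lra.
Qed.

(** * The complex exponential and powers of a positive base *)

Lemma Cexp_plus (z w : C) : Cexp (z + w)%C = (Cexp z * Cexp w)%C.
Proof.
  unfold Cexp, Cmult, Re, Im; simpl. rewrite exp_plus, cos_plus, sin_plus.
  f_equal; ring.
Qed.

Lemma Cexp_0 : Cexp 0%C = 1%C.
Proof. unfold Cexp; simpl. now rewrite exp_0, cos_0, sin_0, Rmult_1_l, Rmult_0_r. Qed.

Lemma Cexp_RtoC (x : R) : Cexp (RtoC x) = RtoC (exp x).
Proof. unfold Cexp; simpl. rewrite cos_0, sin_0, Rmult_1_r, Rmult_0_r. reflexivity. Qed.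

Lemma Cmod_Cexp (z : C) : Cmod (Cexp z) = exp (Re z).
Proof.
  unfold Cmod, Cexp, fst, snd.
  replace (_ + _) with (Rsqr (exp (Re z))).
  - apply sqrt_Rsqr. left; apply exp_pos.
  - pose proof (sin2_cos2 (Im z)). unfold Rsqr in *.
    transitivity (exp (Re z) * exp (Re z) * (sin (Im z) * sin (Im z) + cos (Im z) * cos (Im z))).
    + rewrite H; ring.
    + ring.
Qed.

Lemma Cexp_neq0 (z : C) : Cexp z <> 0%C.
Proof.
  intros H. pose proof (Cmod_Cexp z) as K. rewrite H, Cmod_0 in K.
  pose proof (exp_pos (Re z)). lra.
Qed.

Lemma is_cderive_Cexp (f : R -> C) (t : R) (l : C) :
  is_cderive f t l -> is_cderive (fun t => Cexp (f t)) t (l * Cexp (f t))%C.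
Proof.
  intros [H1 H2].
  assert (He : is_derive (fun t => exp (Re (f t))) t (Re l * exp (Re (f t)))).
  { eapply is_derive_value; [exact (is_derive_comp exp _ _ _ _ (is_derive_exp _) H1)|].
    unfold scal; simpl; unfold mult; simpl; ring. }
  assert (Hc : is_derive (fun t => cos (Im (f t))) t (- Im l * sin (Im (f t)))).
  { eapply is_derive_value; [exact (is_derive_comp cos _ _ _ _ (is_derive_cos _) H2)|].
    unfold scal; simpl; unfold mult; simpl; ring. }
  assert (Hs : is_derive (fun t => sin (Im (f t))) t (Im l * cos (Im (f t)))).
  { eapply is_derive_value; [exact (is_derive_comp sin _ _ _ _ (is_derive_sin _) H2)|].
    unfold scal; simpl; unfold mult; simpl; ring. }
  split.
  - eapply is_derive_value; [exact (is_derive_Rmult _ _ _ _ _ He Hc)|]. simpl. unfold Re, Im; ring.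
  - eapply is_derive_value; [exact (is_derive_Rmult _ _ _ _ _ He Hs)|]. simpl. unfold Re, Im; ring.
Qed.

(** Second-order Taylor for [s -> e^(s w)] from 0 to 1; the second derivative has modulus at most
    [|w|^2 e^|w|] when [|s| <= 1]. *)
Lemma Cmod_Cexp_sub_le (w : C) :
  Cmod (Cexp w - 1 - w)%C <= 2 * exp (Cmod w) * (Cmod w * Cmod w).
Proof.
  pose proof (is_cderive_taylor2 (fun s => Cexp (RtoC s * w)%C) (fun s => w * Cexp (RtoC s * w))%C
    (fun s => w * (w * Cexp (RtoC s * w)))%C 0 1 (Cmod w * Cmod w * exp (Cmod w))) as H.
  replace (0 + 1) with 1 in H by ring.
  replace (Cexp w - 1 - w)%C with
    (Cexp (RtoC 1 * w) - Cexp (RtoC 0 * w) - RtoC 1 * (w * Cexp (RtoC 0 * w)))%C.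
  - replace (2 * exp (Cmod w) * (Cmod w * Cmod w))
      with (2 * (Cmod w * Cmod w * exp (Cmod w)) * (1 * 1)) by ring.
    apply H. intros y Hy.
    assert (D : is_cderive (fun s => Cexp (RtoC s * w)%C) y (w * Cexp (RtoC y * w))%C).
    { apply (is_cderive_Cexp (fun s => RtoC s * w)%C). eapply is_cderive_value.
      - apply is_cderive_mult; [|apply is_cderive_const].
        apply (is_cderive_RtoC (fun s => s)). apply (is_derive_id (K := R_AbsRing)).
      - unfold one; simpl. ring. }
    split; [exact D|]. split; [now apply is_cderive_scal|].
    rewrite !Cmod_mult, Cmod_Cexp.
    rewrite <- Rmult_assoc. apply Rmult_le_compat_l; [pose proof (Cmod_ge_0 w); nra|].
    assert (Hl : Re (RtoC y * w)%C <= Cmod w).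
    { eapply Rle_trans; [apply Rle_abs|]. eapply Rle_trans; [apply re_le_Cmod|].
      rewrite Cmod_mult, Cmod_R. rewrite Rminus_0_r, Rabs_R1 in Hy.
      pose proof (Cmod_ge_0 w). nra. }
    destruct Hl as [Hl|Hl]; [left; now apply exp_increasing | rewrite Hl; lra].
  - rewrite Cmult_0_l, Cexp_0, Cmult_1_l. ring.
Qed.

Lemma RtoC_neq0 (x : R) : x <> 0 -> RtoC x <> 0%C.
Proof. intros H E. apply H. now apply RtoC_inj. Qed.

Lemma Rcpow_plus (t : R) (z w : C) : Rcpow t (z + w)%C = (Rcpow t z * Rcpow t w)%C.
Proof. unfold Rcpow. rewrite <- Cexp_plus. f_equal. ring. Qed.

Lemma Rcpow_neq0 (t : R) (z : C) : Rcpow t z <> 0%C.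
Proof. apply Cexp_neq0. Qed.

Lemma Rcpow_0 (t : R) : Rcpow t 0%C = 1%C.
Proof. unfold Rcpow. rewrite Cmult_0_l. apply Cexp_0. Qed.

Lemma Rcpow_1 (t : R) : 0 < t -> Rcpow t 1%C = RtoC t.
Proof. intros Ht. unfold Rcpow. rewrite Cmult_1_l, Cexp_RtoC, exp_ln; auto. Qed.

Lemma Rcpow_plus1 (t : R) (z : C) : 0 < t -> Rcpow t (z + 1)%C = (RtoC t * Rcpow t z)%C.
Proof. intros Ht. rewrite Rcpow_plus, Rcpow_1 by auto. ring. Qed.

Lemma Rcpow_minus1 (t : R) (z : C) : 0 < t -> Rcpow t (z - 1)%C = (Rcpow t z / RtoC t)%C.
Proof.
  intros Ht. replace z with ((z - 1) + 1)%C at 2 by ring.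
  rewrite Rcpow_plus1 by auto. field. apply RtoC_neq0. lra.
Qed.

Lemma Rcpow_mult_base (s t : R) (z : C) : 0 < s -> 0 < t ->
  Rcpow (s * t) z = (Rcpow s z * Rcpow t z)%C.
Proof.
  intros Hs Ht. unfold Rcpow. rewrite ln_mult by auto. rewrite RtoC_plus, <- Cexp_plus.
  f_equal. ring.
Qed.

Lemma Cmod_Rcpow (t : R) (z : C) : Cmod (Rcpow t z) = exp (Re z * ln t).
Proof. unfold Rcpow. rewrite Cmod_Cexp. f_equal. simpl. unfold Re. ring. Qed.

Lemma is_cderive_Rcpow (t : R) (z : C) : 0 < t ->
  is_cderive (fun t => Rcpow t z) t (z * Rcpow t (z - 1))%C.
Proof.
  intros Ht. eapply is_cderive_value.
  - apply (is_cderive_Cexp (fun t => z * RtoC (ln t))%C).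
    apply is_cderive_scal. apply is_cderive_RtoC. apply is_derive_ln. exact Ht.
  - rewrite Rcpow_minus1 by auto. rewrite RtoC_inv by lra. unfold Rcpow. field. apply RtoC_neq0. lra.
Qed.

Lemma ccontinuous_plus (f g : R -> C) (t : R) :
  ccontinuous f t -> ccontinuous g t -> ccontinuous (fun t => f t + g t)%C t.
Proof.
  intros [H1 H2] [H3 H4].
  split; [exact (continuous_plus _ _ _ H1 H3) | exact (continuous_plus _ _ _ H2 H4)].
Qed.

Lemma ccontinuous_minus (f g : R -> C) (t : R) :
  ccontinuous f t -> ccontinuous g t -> ccontinuous (fun t => f t - g t)%C t.
Proof.
  intros [H1 H2] [H3 H4].
  split; [exact (continuous_minus _ _ _ H1 H3) | exact (continuous_minus _ _ _ H2 H4)].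
Qed.

Lemma ccontinuous_const (k : C) (t : R) : ccontinuous (fun _ => k) t.
Proof. split; apply continuous_const. Qed.

Lemma ccontinuous_RtoC (f : R -> R) (t : R) :
  continuous f t -> ccontinuous (fun t => RtoC (f t)) t.
Proof. intros H. split; [exact H | apply continuous_const]. Qed.

Lemma ccontinuous_scal (k : C) (f : R -> C) (t : R) :
  ccontinuous f t -> ccontinuous (fun t => k * f t)%C t.
Proof. intros H. apply ccontinuous_mult; [apply ccontinuous_const | exact H]. Qed.

Lemma ccontinuous_Rcpow (t : R) (z : C) : 0 < t -> ccontinuous (fun t => Rcpow t z) t.
Proof. intros Ht. eapply is_cderive_continuous. now apply is_cderive_Rcpow. Qed.

(** * Differentiation under the integral sign *)

Local Notation right0 := (at_right 0) (only parsing).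

Lemma exp_le (x y : R) : x <= y -> exp x <= exp y.
Proof. intros [H|H]; [left; now apply exp_increasing | rewrite H; lra]. Qed.

Lemma ln_le_sub1 (x : R) : 0 < x -> ln x <= x - 1.
Proof. intros Hx. pose proof (exp_ineq1_le (ln x)). rewrite exp_ln in H by auto. lra. Qed.

Lemma ln1p_ge0 (s : R) : 0 < s -> 0 <= ln (1 + s).
Proof. intros Hs. rewrite <- ln_1. left. apply ln_increasing; lra. Qed.

(** The square of [e^(u/2) >= 1 + u/2]. It lets an exponential margin swallow the quadratic factor
    of a Taylor remainder. *)
Lemma sqr_le_exp (u : R) : 0 <= u -> u * u <= 4 * exp u.
Proof.
  intros Hu. replace u with (u / 2 + u / 2) at 3 by field. rewrite exp_plus.
  pose proof (exp_ineq1_le (u / 2)). nra.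
Qed.

Lemma at_right0_small (e : R) : 0 < e -> right0 (fun s => 0 < s < e).
Proof.
  intros He. exists (mkposreal e He). intros y Hy Hy0. unfold ball in Hy; simpl in Hy.
  unfold AbsRing_ball, abs, minus, plus, opp in Hy; simpl in Hy. apply Rabs_def2 in Hy. lra.
Qed.

Lemma is_climit_right0 (F : R -> C) (l : C) (K p : R) : 0 < p ->
  (forall s, 0 < s < 1 -> Cmod (F s - l)%C <= K * exp (p * ln s)) ->
  is_climit F right0 l.
Proof.
  intros Hp H eps.
  set (K' := Rabs K + 1). assert (HK' : 0 < K') by (unfold K'; pose proof (Rabs_pos K); lra).
  (* At [s = (eps / K')^(1/p)] the bound [K' s^p] equals [eps]. *)
  assert (He : 0 < exp (ln (eps / K') / p)) by apply exp_pos.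
  assert (Hek : 0 < eps / K') by (apply Rdiv_lt_0_compat; [apply cond_pos|auto]).
  eapply filter_imp; [|exact (filter_and _ _ (at_right0_small 1 Rlt_0_1) (at_right0_small _ He))].
  intros s [H1 H2]. eapply Rle_lt_trans; [apply H; lra|].
  assert (Hl : ln s < ln (eps / K') / p).
  { rewrite <- (ln_exp (ln (eps / K') / p)). apply ln_increasing; lra. }
  assert (Hx : exp (p * ln s) < eps / K').
  { rewrite <- (exp_ln (eps / K')) by auto. apply exp_increasing.
    apply (Rmult_lt_compat_l p) in Hl; [|auto].
    replace (p * (ln (eps / K') / p)) with (ln (eps / K')) in Hl by (field; lra). exact Hl. }
  apply Rle_lt_trans with (K' * exp (p * ln s)).
  - apply Rmult_le_compat_r; [left; apply exp_pos|]. unfold K'. pose proof (Rle_abs K). lra.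
  - apply (Rmult_lt_compat_l K') in Hx; [|auto].
    replace (K' * (eps / K')) with (pos eps) in Hx by (field; lra). exact Hx.
Qed.

Lemma is_climit_pinfty (F : R -> C) (l : C) (K m : R) :
  (forall s, m < s -> 0 < s -> Cmod (F s - l)%C <= K / s) ->
  is_climit F pinfty l.
Proof.
  intros H eps. exists (Rmax (Rmax m 0) (Rabs K / eps)). intros s Hs.
  pose proof (Rmax_l (Rmax m 0) (Rabs K / eps)). pose proof (Rmax_r (Rmax m 0) (Rabs K / eps)).
  pose proof (Rmax_l m 0). pose proof (Rmax_r m 0).
  eapply Rle_lt_trans; [apply H; lra|].
  assert (He := cond_pos eps). assert (Hs2 : Rabs K / eps < s) by lra.
  apply (Rmult_lt_compat_r eps) in Hs2; [|auto].
  replace (Rabs K / eps * eps) with (Rabs K) in Hs2 by (field; lra).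
  apply (Rmult_lt_reg_r s); [lra|]. replace (K / s * s) with K by (field; lra).
  pose proof (Rle_abs K). lra.
Qed.

(* [s^(p-1) (1+s)^q e^(-c s)] *)
Definition gamma_kernel (p q c s : R) : R :=
  exp ((p - 1) * ln s + q * ln (1 + s) - c * s).

(** For [q > 0] the maximum is at [1 + s = q / c], and [ln y <= y - 1] at [y = c (1 + s) / q] yields
    its value. This is how any power of [1 + s] is paid for by a part of the exponential decay. *)
Lemma ln1p_linear_bound (q c : R) : 0 < c -> exists K, forall s, 0 < s ->
  q * ln (1 + s) - c * s <= K.
Proof.
  intros Hc. destruct (Rle_or_lt q 0) as [Hq|Hq].
  - exists 0. intros s Hs. pose proof (ln1p_ge0 s Hs). nra.
  - exists (c - q - q * ln (c / q)). intros s Hs.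
    assert (Hcq : 0 < c / q) by (apply Rdiv_lt_0_compat; lra).
    pose proof (ln_le_sub1 (c / q * (1 + s)) ltac:(apply Rmult_lt_0_compat; lra)) as H.
    rewrite ln_mult in H by lra.
    apply (Rmult_le_compat_l q) in H; [|lra].
    replace (q * (c / q * (1 + s) - 1)) with (c * (1 + s) - q) in H by (field; lra). lra.
Qed.

(** [(s / (1 + s))^p / p] is an antiderivative, with limits 0 and [1 / p]. The kernels below are
    compared with this explicit integral. *)
Lemma ex_RInt_gen_beta_kernel (p : R) : 0 < p ->
  ex_RInt_gen (fun s => exp ((p - 1) * ln s - (p + 1) * ln (1 + s))) right0 pinfty.
Proof.
  intros Hp.
  assert (H : is_CInt_gen
     (fun s => RtoC (exp ((p - 1) * ln s - (p + 1) * ln (1 + s)))) right0 pinfty (RtoC (/ p) - 0)%C).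
  { apply (is_CInt_gen_derive right0 (fun s => RtoC (/ p * exp (p * (ln s - ln (1 + s)))))).
    - apply starts_in_right0.
    - intros t Ht. apply is_cderive_RtoC. auto_derive; [lra|].
      replace (p * (ln t + - ln (1 + t)))
        with (((p - 1) * ln t - (p + 1) * ln (1 + t)) + ln t + ln (1 + t)) by ring.
      rewrite (exp_plus _ (ln (1 + t))), (exp_plus _ (ln t)), !exp_ln by lra. field. lra.
    - intros t Ht. eapply is_cderive_continuous. apply is_cderive_RtoC. auto_derive; [lra|reflexivity].
    - apply (is_climit_right0 _ _ (/ p) p Hp). intros s Hs.
      replace (RtoC (/ p * exp (p * (ln s - ln (1 + s)))) - 0)%C
        with (RtoC (/ p * exp (p * (ln s - ln (1 + s))))) by ring.
      assert (Hip : 0 < / p) by now apply Rinv_0_lt_compat.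
      rewrite Cmod_R, Rabs_pos_eq.
      + apply Rmult_le_compat_l; [lra|]. apply exp_le. pose proof (ln1p_ge0 s ltac:(lra)). nra.
      + apply Rmult_le_pos; [lra|left; apply exp_pos].
    - apply (is_climit_pinfty _ _ 1 0). intros s _ Hs.
      rewrite <- RtoC_minus, Cmod_R.
      assert (Hip : 0 < / p) by now apply Rinv_0_lt_compat.
      assert (H1 : ln s <= ln (1 + s)) by (left; apply ln_increasing; lra).
      assert (H2 : ln (1 + s) - ln s <= / s).
      { rewrite <- ln_div by lra.
        eapply Rle_trans; [apply ln_le_sub1; apply Rdiv_lt_0_compat; lra|]. right; field; lra. }
      assert (H3 : 1 + p * (ln s - ln (1 + s)) <= exp (p * (ln s - ln (1 + s)))) by apply exp_ineq1_le.
      assert (H4 : exp (p * (ln s - ln (1 + s))) <= 1) by (rewrite <- exp_0 at 2; apply exp_le; nra).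
      replace (/ p * exp (p * (ln s - ln (1 + s))) - / p)
        with (- (/ p * (1 - exp (p * (ln s - ln (1 + s)))))) by ring.
      rewrite Rabs_Ropp, Rabs_pos_eq by nra.
      apply (Rmult_le_reg_l p); [auto|]. rewrite <- Rmult_assoc, Rinv_r by lra.
      unfold Rdiv. nra. }
  destruct H as [H _]. eexists. exact H.
Qed.

Lemma ex_RInt_gen_gamma_kernel (p q c : R) : 0 < p -> 0 < c ->
  ex_RInt_gen (gamma_kernel p q c) right0 pinfty.
Proof.
  (* The power [q + p + 1] separates [(1 + s)^q] from the factor [(1 + s)^(-p-1)] of the integrable
     majorant. *)
  intros Hp Hc. destruct (ln1p_linear_bound (q + p + 1) c Hc) as [K HK].
  apply (ex_RInt_gen_dominated _ (fun s => scal (exp K) (exp ((p - 1) * ln s - (p + 1) * ln (1 + s)))));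
    [apply at_right_proper_filter | apply Rbar_locally_filter | |].
  - eapply filter_imp; [|exact (starts_in_prod right0 _ starts_in_right0)].
    intros [a b] [Hab H]; simpl in *. split; [auto|]. intros t Ht. assert (Ht0 := H t ltac:(lra)).
    split.
    + apply (ex_derive_continuous (V := R_NormedModule)). unfold gamma_kernel. auto_derive. lra.
    + unfold gamma_kernel. rewrite Rabs_pos_eq by (left; apply exp_pos).
      unfold scal; simpl; unfold mult; simpl. rewrite <- exp_plus. apply exp_le.
      pose proof (HK t Ht0). lra.
  - destruct (ex_RInt_gen_beta_kernel p Hp) as [l Hl]. eexists.
    apply (is_RInt_gen_scal _ (exp K) _ Hl).
Qed.

Lemma ex_RInt_gen_scal_gamma_kernel (K p q c : R) : 0 < p -> 0 < c ->
  ex_RInt_gen (fun s => K * gamma_kernel p q c s) right0 pinfty.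
Proof.
  intros Hp Hc. destruct (ex_RInt_gen_gamma_kernel p q c Hp Hc) as [l Hl]. eexists.
  exact (is_RInt_gen_scal _ K _ Hl).
Qed.

Lemma is_CInt_gen_gamma_kernel (f : R -> C) (K p q c : R) : 0 < p -> 0 < c ->
  (forall s, 0 < s -> ccontinuous f s) ->
  (forall s, 0 < s -> Cmod (f s) <= K * gamma_kernel p q c s) ->
  is_CInt_gen f right0 pinfty (CInt_gen f right0 pinfty).
Proof.
  intros Hp Hc Hf Hle.
  apply (is_CInt_gen_dominated right0 (fun s => 0 < s) f (fun s => K * gamma_kernel p q c s)); auto.
  - apply starts_in_right0.
  - now apply ex_RInt_gen_scal_gamma_kernel.
Qed.

(** The integrands for [Gamma], for Tricomi's function and for the [kappa]-derivative depend on
    their parameter through [e^(z L(s))], with [L(s)] equal to [ln s], [s] and [ln((1+s)/s)]. The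
    margin [2 d |L|] in the hypothesis is spent in two halves: one to move [z] up to distance [d]
    from [z0], one to absorb the factor [L^2] of the remainder. *)
Lemma CInt_gen_quadratic_remainder (L : R -> R) (B : R -> C) (z0 : C) (d K p q c : R) :
  0 < d -> 0 < p -> 0 < c ->
  (forall s, 0 < s -> continuous L s) -> (forall s, 0 < s -> ccontinuous B s) ->
  (forall s, 0 < s ->
    exp (Re z0 * L s + 2 * d * Rabs (L s)) * Cmod (B s) <= K * gamma_kernel p q c s) ->
  let f := fun z s => (Cexp (z * RtoC (L s)) * B s)%C in
  let Phi := fun z => CInt_gen (f z) right0 pinfty in
  let f1 := fun s => (RtoC (L s) * f z0 s)%C in
  let Phi1 := CInt_gen f1 right0 pinfty in
  (forall z, Cmod (z - z0)%C <= d -> is_CInt_gen (f z) right0 pinfty (Phi z)) /\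
  is_CInt_gen f1 right0 pinfty Phi1 /\
  exists M, forall z, Cmod (z - z0)%C <= d ->
    Cmod (Phi z - Phi z0 - (z - z0) * Phi1)%C <= M * (Cmod (z - z0)%C * Cmod (z - z0)%C).
Proof.
  intros Hd Hp Hc HL HB Hle f Phi f1 Phi1.
  assert (HcE : forall z s, 0 < s -> ccontinuous (fun s => Cexp (z * RtoC (L s))%C) s).
  { intros z s Hs. unfold Cexp. split; simpl.
    - apply (continuous_mult (fun s => exp _) (fun s => cos _)).
      + apply (continuous_comp _ exp); [|apply (ex_derive_continuous (V := R_NormedModule)); auto_derive; trivial].
        apply (continuous_minus (fun s => fst z * L s) (fun s => snd z * 0)).
        * apply (continuous_mult (fun _ => fst z) L); [apply continuous_const|auto].
        * apply continuous_const.
      + apply (continuous_comp _ cos); [|apply (ex_derive_continuous (V := R_NormedModule)); auto_derive; trivial].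
        apply (continuous_plus (fun s => fst z * 0) (fun s => snd z * L s)).
        * apply continuous_const.
        * apply (continuous_mult (fun _ => snd z) L); [apply continuous_const|auto].
    - apply (continuous_mult (fun s => exp _) (fun s => sin _)).
      + apply (continuous_comp _ exp); [|apply (ex_derive_continuous (V := R_NormedModule)); auto_derive; trivial].
        apply (continuous_minus (fun s => fst z * L s) (fun s => snd z * 0)).
        * apply (continuous_mult (fun _ => fst z) L); [apply continuous_const|auto].
        * apply continuous_const.
      + apply (continuous_comp _ sin); [|apply (ex_derive_continuous (V := R_NormedModule)); auto_derive; trivial].
        apply (continuous_plus (fun s => fst z * 0) (fun s => snd z * L s)).
        * apply continuous_const.
        * apply (continuous_mult (fun _ => snd z) L); [apply continuous_const|auto]. }
  assert (Hcf : forall z s, 0 < s -> ccontinuous (f z) s).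
  { intros z s Hs. apply ccontinuous_mult; auto. }
  assert (Hcf1 : forall s, 0 < s -> ccontinuous f1 s).
  { intros s Hs. apply (ccontinuous_mult (fun s => RtoC (L s)) (f z0)); auto.
    split; [now apply HL | apply continuous_const]. }
  assert (Hmod : forall z s, 0 < s -> Cmod (z - z0)%C <= d ->
     Cmod (f z s) <= exp (Re z0 * L s + d * Rabs (L s)) * Cmod (B s)).
  { intros z s Hs Hz. unfold f. rewrite Cmod_mult, Cmod_Cexp.
    apply Rmult_le_compat_r; [apply Cmod_ge_0|]. apply exp_le.
    replace (Re (z * RtoC (L s))%C) with (Re z0 * L s + Re (z - z0)%C * L s) by (simpl; unfold Re; ring).
    apply Rplus_le_compat_l. eapply Rle_trans; [apply Rle_abs|]. rewrite Rabs_mult.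
    apply Rmult_le_compat_r; [apply Rabs_pos|]. eapply Rle_trans; [apply re_le_Cmod|auto]. }
  assert (Hdl : forall s, 0 <= d * Rabs (L s)).
  { intros s. apply Rmult_le_pos; [lra|apply Rabs_pos]. }
  assert (Hmod1 : forall z s, 0 < s -> Cmod (z - z0)%C <= d ->
     Cmod (f z s) <= K * gamma_kernel p q c s).
  { intros z s Hs Hz. eapply Rle_trans; [now apply Hmod|]. eapply Rle_trans; [|now apply Hle].
    apply Rmult_le_compat_r; [apply Cmod_ge_0|]. apply exp_le. pose proof (Hdl s). lra. }
  assert (Hint : forall z, Cmod (z - z0)%C <= d -> is_CInt_gen (f z) right0 pinfty (Phi z)).
  { intros z Hz. apply (is_CInt_gen_gamma_kernel (f z) K p q c); auto. }
  assert (Hz0 : Cmod (z0 - z0)%C <= d).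
  { replace (z0 - z0)%C with (RtoC 0) by ring. rewrite Cmod_0. lra. }
  assert (Hint1 : is_CInt_gen f1 right0 pinfty Phi1).
  (* [d |L| <= e^(d |L|)] absorbs the factor [L] at the price of [1 / d]. *)
  { apply (is_CInt_gen_gamma_kernel f1 (K / d) p q c); auto.
    intros s Hs. unfold f1. rewrite Cmod_mult, Cmod_R.
    apply (Rmult_le_reg_l d); [auto|].
    replace (d * (K / d * gamma_kernel p q c s)) with (K * gamma_kernel p q c s) by (field; lra).
    eapply Rle_trans; [|now apply Hle].
    rewrite <- Rmult_assoc.
    apply Rle_trans with (exp (d * Rabs (L s)) * (exp (Re z0 * L s + d * Rabs (L s)) * Cmod (B s))).
    - apply Rmult_le_compat; auto; [apply Cmod_ge_0|]. pose proof (exp_ineq1_le (d * Rabs (L s))). lra.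
    - rewrite <- Rmult_assoc, <- exp_plus. right. f_equal. f_equal. ring. }
  split; [exact Hint|]. split; [exact Hint1|].
  destruct (ex_RInt_gen_scal_gamma_kernel K p q c Hp Hc) as [I HI].
  (* With [u = d |L|], the factor [2 e^u h^2 L^2] from [Cmod_Cexp_sub_le] is at most
     [8 h^2 / d^2 e^(2u)] by [u^2 <= 4 e^u]. The outer 2 comes from [is_CInt_gen_Cmod_le]. *)
  exists (2 * (8 / (d * d) * I)). intros z Hz.
  set (h := Cmod (z - z0)%C) in *.
  replace (2 * (8 / (d * d) * I) * (h * h)) with (2 * (8 / (d * d) * (h * h) * I)) by ring.
  assert (Hh : 0 <= h) by apply Cmod_ge_0.
  apply (is_CInt_gen_Cmod_le right0 (fun s => 0 < s)
    (fun s => f z s - f z0 s - (z - z0) * f1 s)%C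
    (fun s => 8 / (d * d) * (h * h) * (K * gamma_kernel p q c s))).
  - apply starts_in_right0.
  - intros s Hs.
    set (w := ((z - z0) * RtoC (L s))%C).
    replace (f z s - f z0 s - (z - z0) * f1 s)%C
      with (f z0 s * (Cexp w - 1 - w))%C.
    2:{ unfold f1, f, w. replace (z * RtoC (L s))%C with (z0 * RtoC (L s) + (z - z0) * RtoC (L s))%C by ring.
        rewrite Cexp_plus. ring. }
    rewrite Cmod_mult.
    assert (Hw : Cmod w = h * Rabs (L s)) by (unfold w, h; now rewrite Cmod_mult, Cmod_R).
    pose proof (Cmod_Cexp_sub_le w) as Hr. rewrite Hw in Hr.
    set (u := d * Rabs (L s)).
    assert (Hu : 0 <= u) by apply Hdl.
    assert (Hr2 : Cmod (Cexp w - 1 - w)%C <= 8 / (d * d) * (h * h) * (exp u * exp u)).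
    { eapply Rle_trans; [exact Hr|].
      replace (h * Rabs (L s) * (h * Rabs (L s))) with (h * h / (d * d) * (u * u)) by (unfold u; field; lra).
      replace (8 / (d * d) * (h * h) * (exp u * exp u))
        with (2 * exp u * (h * h / (d * d) * (4 * exp u))) by (field; lra).
      assert (0 <= h * h / (d * d)) by (apply Rdiv_le_0_compat; nra).
      assert (Heu : exp (h * Rabs (L s)) <= exp u)
        by (apply exp_le, Rmult_le_compat_r; [apply Rabs_pos | exact Hz]).
      pose proof (exp_pos (h * Rabs (L s))). pose proof (sqr_le_exp u Hu).
      apply Rmult_le_compat; [lra | | lra |].
      - apply Rmult_le_pos; nra.
      - apply Rmult_le_compat_l; lra. }
    unfold f. rewrite Cmod_mult, Cmod_Cexp.
    replace (Re (z0 * RtoC (L s))%C) with (Re z0 * L s) by (simpl; unfold Re; ring).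
    pose proof (Hle s Hs) as Hk. fold u in Hk.
    replace (Re z0 * L s + 2 * d * Rabs (L s)) with (Re z0 * L s + u + u) in Hk by (unfold u; ring).
    rewrite !exp_plus in Hk.
    apply Rle_trans with (exp (Re z0 * L s) * Cmod (B s) * (8 / (d * d) * (h * h) * (exp u * exp u))).
    + apply Rmult_le_compat_l; [|exact Hr2].
      apply Rmult_le_pos; [left; apply exp_pos | apply Cmod_ge_0].
    + replace (exp (Re z0 * L s) * Cmod (B s) * (8 / (d * d) * (h * h) * (exp u * exp u)))
        with (8 / (d * d) * (h * h) * (exp (Re z0 * L s) * exp u * exp u * Cmod (B s))) by ring.
      apply Rmult_le_compat_l; [|exact Hk].
      apply Rmult_le_pos; [|nra]. apply Rdiv_le_0_compat; nra.
  - apply (is_CInt_gen_minus right0 pinfty (fun s => f z s - f z0 s)%C);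
      [|exact (is_CInt_gen_scal right0 pinfty f1 _ _ Hint1)].
    apply (is_CInt_gen_minus right0 pinfty (f z) (f z0)); auto.
  - apply (is_RInt_gen_scal _ (8 / (d * d) * (h * h)) _ HI).
Qed.

(** * Euler's Gamma function on the right half-plane *)

(** The form that pointwise remainder bounds take after integration. It is preserved by the quotient
    rule and is turned into [is_derive] last. *)
Definition quadratic_derive (F : C -> C) (z0 l : C) : Prop :=
  exists d M : R, 0 < d /\ forall z, Cmod (z - z0)%C <= d ->
    Cmod (F z - F z0 - (z - z0) * l)%C <= M * (Cmod (z - z0)%C * Cmod (z - z0)%C).

Lemma quadratic_derive_nonneg (F : C -> C) (z0 l : C) : quadratic_derive F z0 l ->
  exists d M : R, 0 < d /\ 0 <= M /\ forall z, Cmod (z - z0)%C <= d ->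
    Cmod (F z - F z0 - (z - z0) * l)%C <= M * (Cmod (z - z0)%C * Cmod (z - z0)%C).
Proof.
  intros [d [M [Hd H]]]. exists d, (Rabs M). split; [auto|]. split; [apply Rabs_pos|].
  intros z Hz. eapply Rle_trans; [now apply H|]. apply Rmult_le_compat_r; [|apply Rle_abs].
  pose proof (Cmod_ge_0 (z - z0)%C). nra.
Qed.

Lemma quadratic_derive_is_derive (F : C -> C) (z0 l : C) :
  quadratic_derive F z0 l -> is_derive (K := C_AbsRing) (V := C_NormedModule) F z0 l.
Proof.
  intros H. destruct (quadratic_derive_nonneg F z0 l H) as [d [M [Hd [HM K]]]].
  split; [apply is_linear_scal_l|].
  intros x Hx. apply (is_filter_lim_locally_unique (V := AbsRing_NormedModule C_AbsRing)) in Hx.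
  subst x. intros eps.
  assert (Hm : 0 < Rmin d (eps / (M + 1))).
  { apply Rmin_case; [auto|]. apply Rdiv_lt_0_compat; [apply cond_pos|lra]. }
  exists (mkposreal _ Hm). intros z Hz.
  assert (Hz' : Cmod (z - z0)%C < Rmin d (eps / (M + 1))) by exact Hz.
  pose proof (Rmin_l d (eps / (M + 1))). pose proof (Rmin_r d (eps / (M + 1))).
  change (Cmod (F z - F z0 - (z - z0) * l)%C <= eps * Cmod (z - z0)%C).
  eapply Rle_trans; [apply K; lra|].
  pose proof (Cmod_ge_0 (z - z0)%C). rewrite <- Rmult_assoc. apply Rmult_le_compat_r; [auto|].
  apply Rle_trans with ((M + 1) * (eps / (M + 1))); [|right; field; lra].
  apply Rmult_le_compat; lra.
Qed.

Lemma quadratic_derive_div (N G : C -> C) (z0 l m : C) : G z0 <> 0%C ->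
  quadratic_derive N z0 l -> quadratic_derive G z0 m ->
  quadratic_derive (fun z => N z / G z)%C z0 ((l * G z0 - N z0 * m) / (G z0 * G z0))%C.
Proof.
  intros HG HN HGd.
  destruct (quadratic_derive_nonneg _ _ _ HN) as [d1 [M1 [Hd1 [HM1 K1]]]].
  destruct (quadratic_derive_nonneg _ _ _ HGd) as [d2 [M2 [Hd2 [HM2 K2]]]].
  set (g0 := Cmod (G z0)). assert (Hg0 : 0 < g0) by (now apply Cmod_gt_0).
  (* [A |h|] bounds the increment of [G] when [|h| <= 1]; for [|h| <= g0 / (2 A)] the denominator
     then keeps modulus at least [g0 / 2]. *)
  set (A := M2 + Cmod m + 1).
  assert (HA : 0 < A) by (unfold A; pose proof (Cmod_ge_0 m); lra).
  set (d := Rmin (Rmin d1 d2) (Rmin 1 (g0 / (2 * A)))).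
  assert (Hd : 0 < d).
  { unfold d. repeat apply Rmin_case; auto; try lra. apply Rdiv_lt_0_compat; lra. }
  set (c := (l * G z0 - N z0 * m)%C).
  exists d, ((M1 * (g0 * g0) + Cmod (N z0) * g0 * M2 + Cmod c * A) * (2 / (g0 * g0 * g0))).
  split; [auto|]. intros z Hz.
  assert (Hz1 : Cmod (z - z0)%C <= Rmin d1 d2) by (eapply Rle_trans; [exact Hz|apply Rmin_l]).
  assert (Hz2 : Cmod (z - z0)%C <= Rmin 1 (g0 / (2 * A))) by (eapply Rle_trans; [exact Hz|apply Rmin_r]).
  pose proof (Rmin_l d1 d2). pose proof (Rmin_r d1 d2).
  pose proof (Rmin_l 1 (g0 / (2 * A))). pose proof (Rmin_r 1 (g0 / (2 * A))).
  specialize (K1 z ltac:(lra)). specialize (K2 z ltac:(lra)).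
  set (h := (z - z0)%C) in *. pose proof (Cmod_ge_0 h) as Hh.
  set (r := (N z - N z0 - h * l)%C) in *. set (rho := (G z - G z0 - h * m)%C) in *.
  assert (Hinc : Cmod (h * m + rho)%C <= A * Cmod h).
  { eapply Rle_trans; [apply Cmod_triangle|]. rewrite Cmod_mult. unfold A.
    assert (M2 * (Cmod h * Cmod h) <= M2 * Cmod h) by (apply Rmult_le_compat_l; nra). lra. }
  assert (Hsmall : A * Cmod h <= g0 / 2).
  { apply Rle_trans with (A * (g0 / (2 * A))); [apply Rmult_le_compat_l; lra|right; field; lra]. }
  assert (HGz : g0 / 2 <= Cmod (G z)).
  { assert (g0 <= Cmod (G z) + Cmod (h * m + rho)%C).
    { unfold g0. replace (G z0) with (G z + - (h * m + rho))%C by (unfold rho; ring).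
      eapply Rle_trans; [apply Cmod_triangle|]. rewrite Cmod_opp. lra. }
    lra. }
  assert (HGz0 : G z <> 0%C) by (apply Cmod_gt_0; lra).
  (* The first-order terms cancel by the choice of [c]; each of the three terms left in the
     numerator is of order [|h|^2]. *)
  replace (N z / G z - N z0 / G z0 - h * (c / (G z0 * G z0)))%C
    with ((r * (G z0 * G z0) - N z0 * G z0 * rho - h * c * (h * m + rho)) / (G z * (G z0 * G z0)))%C.
  2:{ unfold c, r, rho. field. split; auto. }
  rewrite Cmod_div, !Cmod_mult by (repeat apply Cmult_neq_0; auto). fold g0.
  unfold Rdiv at 1.
  replace ((M1 * (g0 * g0) + Cmod (N z0) * g0 * M2 + Cmod c * A) * (2 / (g0 * g0 * g0)) * (Cmod h * Cmod h))
   with ((M1 * (g0 * g0) + Cmod (N z0) * g0 * M2 + Cmod c * A) * (Cmod h * Cmod h) * (/ (g0 / 2 * (g0 * g0))))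
   by (field; lra).
  apply Rmult_le_compat.
  - apply Cmod_ge_0.
  - left. apply Rinv_0_lt_compat. apply Rmult_lt_0_compat; nra.
  - unfold Cminus. eapply Rle_trans; [apply Cmod_triangle|].
    eapply Rle_trans; [apply Rplus_le_compat_r, Cmod_triangle|].
    rewrite !Cmod_opp, !Cmod_mult. fold g0.
    pose proof (Cmod_ge_0 (N z0)). pose proof (Cmod_ge_0 c).
    assert (Cmod r * (g0 * g0) <= M1 * (Cmod h * Cmod h) * (g0 * g0)) by (apply Rmult_le_compat_r; nra).
    assert (Cmod (N z0) * g0 * Cmod rho <= Cmod (N z0) * g0 * (M2 * (Cmod h * Cmod h)))
      by (apply Rmult_le_compat_l; nra).
    assert (Cmod h * Cmod c * Cmod (h * m + rho)%C <= Cmod h * Cmod c * (A * Cmod h))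
      by (apply Rmult_le_compat_l; nra).
    lra.
  - apply Rinv_le_contravar; [apply Rmult_lt_0_compat; nra|]. apply Rmult_le_compat_r; nra.
Qed.

Lemma quadratic_derive_affine_comp (F : C -> C) (w z0 l : C) :
  quadratic_derive F (w - z0)%C l -> quadratic_derive (fun z => F (w - z)%C) z0 (- l)%C.
Proof.
  intros [d [M [Hd H]]]. exists d, M. split; [auto|]. intros z Hz.
  specialize (H (w - z)%C).
  replace (w - z - (w - z0))%C with (- (z - z0))%C in H by ring. rewrite Cmod_opp in H.
  replace (F (w - z) - F (w - z0) - (z - z0) * - l)%C
    with (F (w - z) - F (w - z0) - - (z - z0) * l)%C by ring.
  now apply H.
Qed.

Lemma quadratic_derive_ext (F G : C -> C) (z0 l : C) (e : R) : 0 < e ->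
  (forall z, Cmod (z - z0)%C <= e -> F z = G z) ->
  quadratic_derive F z0 l -> quadratic_derive G z0 l.
Proof.
  intros He HFG [d [M [Hd H]]]. exists (Rmin d e), M.
  split; [now apply Rmin_case|]. intros z Hz.
  pose proof (Rmin_l d e). pose proof (Rmin_r d e).
  rewrite <- (HFG z), <- (HFG z0); [apply H; lra| |lra].
  replace (z0 - z0)%C with (RtoC 0) by ring. rewrite Cmod_0. lra.
Qed.

Lemma exp_div_l (x s : R) : 0 < s -> exp x / s = exp (x - ln s).
Proof. intros Hs. unfold Rminus. now rewrite exp_plus, (exp_Ropp (ln s)), exp_ln. Qed.

(** Turns a margin in [|ln s|] into exponents of the kernel: [- ln s] serves for [s < 1],
    [2 ln(1 + s)] for [s >= 1]. *)
Lemma Rabs_ln_le (s : R) : 0 < s -> Rabs (ln s) <= 2 * ln (1 + s) - ln s.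
Proof.
  intros Hs. pose proof (ln1p_ge0 s Hs). assert (ln s < ln (1 + s)) by (apply ln_increasing; lra).
  unfold Rabs; destruct Rcase_abs; lra.
Qed.

Lemma Gamma_integrand_Cexp (z : C) (s : R) : 0 < s ->
  (Cexp (z * RtoC (ln s)) * RtoC (exp (- s) / s) = Rcpow s (z - 1) * RtoC (exp (- s)))%C.
Proof.
  intros Hs. rewrite Rcpow_minus1 by auto. unfold Rcpow. rewrite RtoC_div by lra.
  field. apply RtoC_neq0; lra.
Qed.

Lemma CGamma_param (z0 : C) : 0 < Re z0 ->
  (is_CInt_gen (fun t => Rcpow t (z0 - 1) * RtoC (exp (- t)))%C right0 pinfty (CGamma z0)) /\
  exists l, quadratic_derive CGamma z0 l.
Proof.
  intros Hz0. set (sg := Re z0) in *.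
  (* Half of the exponent of [s] is given up: the margin [(sg / 2) |ln s|] costs at most
     [s^(-sg/2) (1 + s)^sg]. *)
  destruct (CInt_gen_quadratic_remainder ln (fun s => RtoC (exp (- s) / s)) z0 (sg / 4) 1 (sg / 2) sg 1)
    as [H1 [H2 [M H3]]]; try lra.
  - intros s Hs. apply (ex_derive_continuous (V := R_NormedModule)). auto_derive; auto.
  - intros s Hs. eapply is_cderive_continuous. apply is_cderive_RtoC. auto_derive; [lra|reflexivity].
  - intros s Hs. rewrite Cmod_R. fold sg. rewrite exp_div_l by auto.
    rewrite (Rabs_pos_eq (exp _)) by (left; apply exp_pos).
    rewrite <- exp_plus, Rmult_1_l. apply exp_le.
    pose proof (Rabs_ln_le s Hs). nra.
  - assert (E : forall z, Cmod (z - z0)%C <= sg / 4 ->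
      CInt_gen (fun s => Cexp (z * RtoC (ln s)) * RtoC (exp (- s) / s))%C right0 pinfty = CGamma z /\
      is_CInt_gen (fun t => Rcpow t (z - 1) * RtoC (exp (- t)))%C right0 pinfty (CGamma z)).
    { intros z Hz. specialize (H1 z Hz).
      apply (is_CInt_gen_ext right0 (fun s => 0 < s) _ (fun t => Rcpow t (z - 1) * RtoC (exp (- t)))%C) in H1.
      - pose proof (is_CInt_gen_unique _ right0 pinfty _ H1) as E. split.
        + symmetry. exact E.
        + unfold CGamma at 1. rewrite E. exact H1.
      - apply starts_in_right0.
      - intros t Ht. now apply Gamma_integrand_Cexp. }
    assert (Hz00 : Cmod (z0 - z0)%C <= sg / 4).
    { replace (z0 - z0)%C with (RtoC 0) by ring. rewrite Cmod_0. lra. }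
    split; [now apply E|]. eexists. exists (sg / 4), M. split; [lra|].
    intros z Hz. destruct (E z Hz) as [<- _]. destruct (E z0 Hz00) as [<- _].
    apply (H3 z Hz).
Qed.

Lemma CGamma_integral (z : C) : 0 < Re z ->
  is_CInt_gen (fun t => Rcpow t (z - 1) * RtoC (exp (- t)))%C right0 pinfty (CGamma z).
Proof. intros H. apply (proj1 (CGamma_param z H)). Qed.

Lemma CGamma_derive (z : C) : 0 < Re z -> quadratic_derive CGamma z (C_derive CGamma z).
Proof.
  intros H. destruct (CGamma_param z H) as [_ [l Hl]].
  rewrite (is_C_derive_unique _ _ l); [exact Hl|]. now apply quadratic_derive_is_derive.
Qed.

(* At [0] and at [+oo], the boundary terms of all integrations by parts below are of this form. *)
Lemma is_climit_boundary (F : R -> C) (K p q c : R) : 0 < p -> 0 < c ->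
  (forall s, 0 < s -> Cmod (F s) <= K * gamma_kernel (p + 1) q c s) ->
  is_climit F right0 0%C /\ is_climit F pinfty 0%C.
Proof.
  intros Hp Hc H. destruct (ln1p_linear_bound q c Hc) as [K1 HK1].
  (* One power more than the growth of the kernel, so that the bound at +oo is [K e^K2 / s]. *)
  destruct (ln1p_linear_bound (p + 1 + Rabs q) c Hc) as [K2 HK2].
  assert (HK : 0 <= K).
  { specialize (H 1 Rlt_0_1). pose proof (Cmod_ge_0 (F 1)).
    assert (0 < gamma_kernel (p + 1) q c 1) by apply exp_pos. nra. }
  split.
  - apply (is_climit_right0 F 0%C (K * exp K1) p Hp). intros s [Hs _].
    replace (F s - 0)%C with (F s) by ring. eapply Rle_trans; [now apply H|].
    rewrite Rmult_assoc. apply Rmult_le_compat_l; [auto|]. unfold gamma_kernel.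
    rewrite <- exp_plus. apply exp_le. pose proof (HK1 s Hs). lra.
  - apply (is_climit_pinfty F 0%C (K * exp K2) 0). intros s _ Hs.
    replace (F s - 0)%C with (F s) by ring. eapply Rle_trans; [now apply H|].
    unfold Rdiv. rewrite Rmult_assoc. apply Rmult_le_compat_l; [auto|]. unfold gamma_kernel.
    fold (exp K2 / s). rewrite exp_div_l by auto. apply exp_le.
    pose proof (HK2 s Hs). pose proof (ln1p_ge0 s Hs).
    assert (ln s < ln (1 + s)) by (apply ln_increasing; lra).
    pose proof (Rle_abs q). nra.
Qed.

Lemma CGamma_plus1 (z : C) : 0 < Re z -> CGamma (z + 1)%C = (z * CGamma z)%C.
Proof.
  intros Hz.
  assert (D : forall t, 0 < t -> is_cderive (fun t => Rcpow t z * RtoC (exp (- t)))%C t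
     (z * (Rcpow t (z - 1) * RtoC (exp (- t))) - Rcpow t (z + 1 - 1) * RtoC (exp (- t)))%C).
  { intros t Ht. eapply is_cderive_value.
    - apply is_cderive_mult; [now apply is_cderive_Rcpow|]. apply is_cderive_RtoC.
      auto_derive; [trivial|reflexivity].
    - replace (z + 1 - 1)%C with z by ring. rewrite <- ?RtoC_opp.
      replace (- (1) * exp (- t)) with (- exp (- t)) by ring. rewrite RtoC_opp. ring. }
  assert (Hz1 : 0 < Re (z + 1)%C) by (simpl; unfold Re in *; lra).
  pose proof (is_CInt_gen_minus right0 pinfty _ _ _ _
     (is_CInt_gen_scal right0 pinfty _ z _ (CGamma_integral z Hz)) (CGamma_integral _ Hz1)) as H1.
  destruct (is_climit_boundary (fun t => Rcpow t z * RtoC (exp (- t)))%C 1 (Re z) 0 1) as [L0 L1]; try lra.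
  { intros s Hs. rewrite Cmod_mult, Cmod_Rcpow, Cmod_R, Rabs_pos_eq by (left; apply exp_pos).
    rewrite <- exp_plus, Rmult_1_l. apply exp_le. right; ring. }
  assert (Hc : forall w s, 0 < s -> ccontinuous (fun t => Rcpow t w * RtoC (exp (- t)))%C s).
  { intros w s Hs. apply ccontinuous_mult; [now apply ccontinuous_Rcpow|]. apply ccontinuous_RtoC.
    apply (ex_derive_continuous (V := R_NormedModule)). auto_derive. trivial. }
  assert (H2 := is_CInt_gen_derive right0 _ _ 0%C 0%C starts_in_right0 D
    (fun t Ht => ccontinuous_minus _ _ t (ccontinuous_scal z _ t (Hc _ t Ht)) (Hc _ t Ht)) L0 L1).
  apply (is_CInt_gen_unique _ right0 pinfty) in H1. apply (is_CInt_gen_unique _ right0 pinfty) in H2.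
  rewrite H2 in H1.
  transitivity (z * CGamma z - (z * CGamma z - CGamma (z + 1)))%C; [ring|]. rewrite <- H1. ring.
Qed.

(** * Gamma has no zero in the right half-plane *)

Lemma RInt_gen_pos (g : R -> R) (l : R) :
  (forall s, 0 < s -> continuous g s) -> (forall s, 0 < s -> 0 < g s) ->
  is_RInt_gen g right0 pinfty l -> 0 < l.
Proof.
  intros Hc Hp Hl.
  assert (Hex : forall a b, 0 < a -> a <= b -> ex_RInt g a b).
  { intros a b Ha Hab. apply (ex_RInt_continuous (V := R_CompleteNormedModule)).
    intros z Hz. rewrite Rmin_left in Hz by lra. apply Hc. lra. }
  assert (He : 0 < RInt g 1 2).
  (* The integral over [1, 2] is a strictly positive lower bound for the integral over every larger
     interval. *)
  { apply RInt_gt_0; [lra| |]; intros x Hx; [apply Hp | apply Hc]; lra. }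
  assert (He2 : 0 < RInt g 1 2 / 2) by lra.
  pose proof (proj1 (filterlimi_locally (F := filter_prod right0 pinfty) _ _) Hl (mkposreal _ He2)) as K.
  assert (K2 : filter_prod right0 pinfty (fun ab => 0 < fst ab < 1 /\ 2 < snd ab)).
  { eapply Filter_prod; [exact (at_right0_small 1 Rlt_0_1) | exists 2; intros x Hx; exact Hx |].
    intros a b Ha Hb; simpl in *; lra. }
  destruct (filter_ex (F := filter_prod right0 pinfty) _ (filter_and _ _ K K2))
    as [[a b] [[z [Hz Hb]] [Ha Hb2]]]. simpl in *.
  apply (is_RInt_unique (V := R_CompleteNormedModule)) in Hz.
  assert (RInt g 1 2 <= z).
  { rewrite <- Hz.
    rewrite <- (RInt_Chasles g a 1 b) by (apply Hex; lra).
    rewrite <- (RInt_Chasles g 1 2 b) by (apply Hex; lra).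
    assert (0 <= RInt g a 1).
    { apply RInt_ge_0; [lra|apply Hex; lra|]. intros x Hx. left; apply Hp; lra. }
    assert (0 <= RInt g 2 b).
    { apply RInt_ge_0; [lra|apply Hex; lra|]. intros x Hx. left; apply Hp; lra. }
    unfold plus; simpl. lra. }
  unfold ball in Hb; simpl in Hb. unfold AbsRing_ball, abs, minus, plus, opp in Hb; simpl in Hb.
  apply Rabs_def2 in Hb. lra.
Qed.

Lemma sin_sqr_le (x : R) : sin x * sin x <= x * x.
Proof.
  destruct (MVT_gen sin 0 x cos) as [c [_ Ec]].
  - intros y _. apply is_derive_sin.
  - intros y _. apply continuity_sin.
  - rewrite sin_0, !Rminus_0_r in Ec. rewrite Ec.
    pose proof (COS_bound c). pose proof (sin2_cos2 c). unfold Rsqr in *.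
    pose proof (Rle_0_sqr (sin c)). unfold Rsqr in *. nra.
Qed.

Lemma cos_ge_quadratic (u : R) : 1 - u * u / 2 <= cos u.
Proof.
  replace u with (2 * (u / 2)) at 3 by field. rewrite cos_2a_sin.
  pose proof (sin_sqr_le (u / 2)). nra.
Qed.

(** With [x = e^(2v)] this is [|v| <= |sinh v|], and the mean value theorem gives
    [sinh v = v cosh c] with [cosh c >= 1]. *)
Lemma ln_sqr_le (x : R) : 0 < x -> ln x * ln x <= (x - 1) * (x - 1) / x.
Proof.
  intros Hx. set (v := ln x / 2).
  destruct (MVT_gen (fun v => exp v - exp (- v)) 0 v (fun v => exp v + exp (- v))) as [c [_ Ec]].
  - intros y _. auto_derive; [trivial|ring].
  - intros y _. apply derivable_continuous_pt. exists (exp y + exp (- y)).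
    apply is_derive_Reals. auto_derive; [trivial|ring].
  - rewrite Ropp_0, !Rminus_0_r in Ec. replace (exp 0 - exp 0) with 0 in Ec by ring.
    rewrite Rminus_0_r in Ec.
    assert (H2 : 2 <= exp c + exp (- c)).
    { pose proof (exp_ineq1_le c). pose proof (exp_ineq1_le (- c)). lra. }
    assert (Hev : exp v * exp v = x).
    { rewrite <- exp_plus. unfold v. replace (ln x / 2 + ln x / 2) with (ln x) by field. now apply exp_ln. }
    assert (Hev' : exp v * exp (- v) = 1) by (rewrite <- exp_plus, Rplus_opp_r; apply exp_0).
    replace ((x - 1) * (x - 1) / x) with ((exp v - exp (- v)) * (exp v - exp (- v))).
    + rewrite Ec. replace (ln x) with (2 * v) by (unfold v; field).
      pose proof (Rle_0_sqr v). unfold Rsqr in *.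
      assert (4 <= (exp c + exp (- c)) * (exp c + exp (- c))) by nra. nra.
    + assert (0 < exp v) by apply exp_pos.
      assert (E : exp (- v) = / exp v) by apply exp_Ropp. rewrite E, <- Hev. field. lra.
Qed.

(* For [m = Re z - 1], the phase [Im z * ln s] of the integrand varies little over the bulk of
   [s^m e^(-s)], which sits around [s = m] with width [sqrt m]. *)
Lemma CGamma_neq0_large (z : C) : 1 < Re z -> Im z * Im z < 2 * (Re z - 1) -> CGamma z <> 0%C.
Proof.
  intros Hz Hy HG. set (m := Re z - 1) in *. set (y := Im z) in *.
  assert (Hm : 0 < m) by (unfold m; lra).
  (* [k] bounds the relative loss when the cosine of the phase is replaced by 1: [1 - cos] is at
     most half the squared phase, hence at most [k (s - m)^2 / s], whose mean against [s^m e^(-s)]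
     is [k]. *)
  set (k := y * y / (2 * m)).
  assert (Hk : k < 1).
  { unfold k. apply (Rmult_lt_reg_r (2 * m)); [lra|].
    replace (y * y / (2 * m) * (2 * m)) with (y * y) by (field; lra). lra. }
  set (f := fun s => exp (m * ln s - s)).
  (* The derivative of [F] is [((s - m)^2 / s - 1) f]. As [F] vanishes at both ends, the mean of
     [(s - m)^2 / s] against [f] is 1. *)
  set (F := fun s => RtoC (- (s - m) * f s)).
  set (F1 := fun s => RtoC ((s - m) * (s - m) * f s / s - f s)).
  assert (HF : forall s, 0 < s -> is_cderive F s (F1 s)).
  { intros s Hs. apply is_cderive_RtoC. unfold f. auto_derive; [lra|]. unfold Rminus. field. lra. }
  assert (HF1c : forall s, 0 < s -> ccontinuous F1 s).
  { intros s Hs. eapply is_cderive_continuous. apply is_cderive_RtoC. unfold f.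
    auto_derive; [lra|reflexivity]. }
  destruct (is_climit_boundary F (1 + m) m 1 1) as [L0 L1]; try lra.
  { intros s Hs. unfold F, f. rewrite Cmod_R, Rabs_mult, (Rabs_pos_eq (exp _)) by (left; apply exp_pos).
    unfold gamma_kernel.
    replace ((m + 1 - 1) * ln s + 1 * ln (1 + s) - 1 * s) with ((m * ln s - s) + ln (1 + s)) by ring.
    rewrite exp_plus, exp_ln by lra.
    assert (Rabs (- (s - m)) <= (1 + m) * (1 + s)) by (unfold Rabs; destruct Rcase_abs; nra).
    pose proof (exp_pos (m * ln s - s)). nra. }
  pose proof (is_CInt_gen_derive right0 F F1 0%C 0%C starts_in_right0 HF HF1c L0 L1) as [HI1 _].
  assert (Hfi : exists l, is_RInt_gen f right0 pinfty l).
  { destruct (ex_RInt_gen_gamma_kernel (m + 1) 0 1) as [l Hl]; try lra. exists l.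
    eapply is_RInt_gen_ext; [|exact Hl]. apply filter_forall. intros [a b] s _.
    unfold gamma_kernel, f. f_equal. ring. }
  destruct Hfi as [l Hl].
  assert (Hlpos : 0 < l).
  { apply (RInt_gen_pos f); auto; intros s Hs.
    - apply (ex_derive_continuous (V := R_NormedModule)). unfold f. auto_derive. lra.
    - apply exp_pos. }
  pose proof (CGamma_integral z ltac:(lra)) as HG1.
  (* The factor [m^(-i y)] makes the phase vanish at the peak [s = m]. *)
  apply (is_CInt_gen_scal right0 pinfty _ (Cexp (0, (- (y * ln m))%R))) in HG1.
  rewrite HG, Cmult_0_r in HG1. destruct HG1 as [HG1 _].
  (* [Re (m^(-i y) Gamma z) >= (1 - k) l], since [F1] integrates to [0]. *)
  set (g := fun s => Re (Cexp (0, (- (y * ln m))%R) * (Rcpow s (z - 1) * RtoC (exp (- s))))%C) in HG1.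
  pose proof (is_RInt_gen_minus _ _ _ _ (is_RInt_gen_scal _ (1 - k) _ Hl) (is_RInt_gen_scal _ k _ HI1)) as HI2.
  set (g2 := fun s => minus (scal (1 - k) (f s)) (scal k (Re (F1 s)))) in HI2.
  assert (Hle : forall s, 0 < s -> g2 s <= g s).
  { intros s Hs.
    assert (Eg : g s = f s * cos (y * ln (s / m))).
    { unfold g. rewrite Cmult_assoc. unfold Rcpow. rewrite <- Cexp_plus.
      rewrite <- Cexp_RtoC, <- Cexp_plus.
      replace (_ + _)%C with ((m * ln s - s, y * ln (s / m)) : C).
      - unfold Cexp, f. simpl. reflexivity.
      - rewrite ln_div by auto. unfold m, y. apply injective_projections; simpl; unfold Re, Im; ring. }
    rewrite Eg. unfold g2, F1, minus, plus, opp, scal; simpl. unfold mult; simpl.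
    assert (Hf : 0 < f s) by apply exp_pos.
    pose proof (cos_ge_quadratic (y * ln (s / m))) as Hcos.
    pose proof (ln_sqr_le (s / m) ltac:(now apply Rdiv_lt_0_compat)) as Hln.
    replace ((s / m - 1) * (s / m - 1) / (s / m)) with ((s - m) * (s - m) / (s * m)) in Hln by (field; lra).
    assert (Hy2 : y * ln (s / m) * (y * ln (s / m)) / 2 <= k * ((s - m) * (s - m) / s)).
    { replace (k * ((s - m) * (s - m) / s)) with (y * y / 2 * ((s - m) * (s - m) / (s * m)))
        by (unfold k; field; lra).
      replace (y * ln (s / m) * (y * ln (s / m)) / 2) with (y * y / 2 * (ln (s / m) * ln (s / m))) by field.
      apply Rmult_le_compat_l; [nra|exact Hln]. }
    replace ((1 - k) * f s + - (k * ((s - m) * (s - m) * f s / s - f s)))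
      with (f s * (1 - k * ((s - m) * (s - m) / s))) by (field; lra).
    apply Rmult_le_compat_l; lra. }
  pose proof (is_RInt_gen_minus _ _ _ _ HG1 HI2) as HI3.
  pose proof (is_RInt_gen_opp _ _ (is_RInt_gen_opp _ _ HI3)) as HI4.
  (* The nonnegative function [g - g2] is a majorant of its own norm, so its integral is at least a
     norm and cannot be negative. But this integral is [- (1 - k) l], with [k < 1] and [l > 0]. *)
  assert (Hneg : norm (minus (Re (RtoC 0)) (minus (scal (1 - k) l) (scal k (Re (0 - 0)%C))))
     <= minus (Re (RtoC 0)) (minus (scal (1 - k) l) (scal k (Re (0 - 0)%C)))).
  { apply (RInt_gen_norm (V := R_CompleteNormedModule) (Fa := right0) (Fb := pinfty)
      (fun s => minus (g s) (g2 s)) (fun s => minus (g s) (g2 s))); auto.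
    - eapply filter_imp; [|exact (starts_in_prod right0 _ starts_in_right0)]. now intros [a b] [H _].
    - eapply filter_imp; [|exact (starts_in_prod right0 _ starts_in_right0)].
      intros [a b] [H H0] s Hs; simpl in *. specialize (Hle s ltac:(apply H0; lra)).
      unfold norm, minus, plus, opp; simpl. unfold abs; simpl. rewrite Rabs_pos_eq; lra. }
  unfold norm, minus, plus, opp, scal in Hneg; simpl in Hneg. unfold mult, abs in Hneg; simpl in Hneg.
  match type of Hneg with Rabs ?X <= _ => pose proof (Rabs_pos X) end. nra.
Qed.

(** A zero at [z] propagates to every [z + n], and for large [n] the real part outgrows the fixed
    square of [Im z]. *)
Lemma CGamma_neq0 (z : C) : 0 < Re z -> CGamma z <> 0%C.
Proof.
  intros Hz HG.
  assert (H : forall n : nat, CGamma (z + RtoC (INR n))%C = 0%C).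
  { induction n as [|n IH].
    - simpl. now rewrite Cplus_0_r.
    - rewrite S_INR, RtoC_plus, Cplus_assoc, CGamma_plus1, IH; [ring|].
      simpl. pose proof (pos_INR n). unfold Re in *; lra. }
  destruct (nfloor_ex (1 + Im z * Im z)) as [n [_ Hn]]; [nra|].
  apply (CGamma_neq0_large (z + RtoC (INR (S n)))%C); [| |apply H];
    rewrite S_INR; simpl; unfold Re, Im in *; pose proof (pos_INR n); nra.
Qed.

(** * The integral representation of Tricomi's function *)

Lemma quadratic_is_derive (f : R -> R) (t l d M : R) : 0 < d ->
  (forall h, Rabs h <= d -> Rabs (f (t + h) - f t - h * l) <= M * (h * h)) ->
  is_derive f t l.
Proof.
  intros Hd H. split; [apply is_linear_scal_l|].
  intros x Hx. apply (is_filter_lim_locally_unique (V := AbsRing_NormedModule R_AbsRing)) in Hx.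
  subst x. intros eps.
  assert (HM : 0 < Rabs M + 1) by (pose proof (Rabs_pos M); lra).
  assert (Hm : 0 < Rmin d (eps / (Rabs M + 1))).
  { apply Rmin_case; [auto|]. apply Rdiv_lt_0_compat; [apply cond_pos|lra]. }
  exists (mkposreal _ Hm). intros z Hz.
  assert (Hz' : Rabs (z - t) < Rmin d (eps / (Rabs M + 1))) by exact Hz.
  pose proof (Rmin_l d (eps / (Rabs M + 1))). pose proof (Rmin_r d (eps / (Rabs M + 1))).
  change (Rabs (f z - f t - (z - t) * l) <= eps * Rabs (z - t)).
  specialize (H (z - t) ltac:(lra)).
  assert (E : forall u v : R, v + (u - v) = u) by (intros; ring). rewrite E in H.
  eapply Rle_trans; [exact H|].
  rewrite <- (Rabs_pos_eq ((z - t) * (z - t))), Rabs_mult by apply Rle_0_sqr.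
  rewrite <- Rmult_assoc. apply Rmult_le_compat_r; [apply Rabs_pos|].
  apply Rle_trans with ((Rabs M + 1) * (eps / (Rabs M + 1))); [|right; field; lra].
  pose proof (Rabs_pos (z - t)). pose proof (Rle_abs M).
  apply Rle_trans with ((Rabs M + 1) * Rabs (z - t)); [apply Rmult_le_compat_r; lra|].
  apply Rmult_le_compat_l; lra.
Qed.

Lemma quadratic_is_cderive (f : R -> C) (t : R) (l : C) (d M : R) : 0 < d ->
  (forall h, Rabs h <= d -> Cmod (f (t + h)%R - f t - RtoC h * l)%C <= M * (h * h)) ->
  is_cderive f t l.
Proof.
  intros Hd H.
  split; apply (quadratic_is_derive _ _ _ d M Hd); intros h Hh;
    (eapply Rle_trans; [|exact (H h Hh)]).
  - replace (Re (f (t + h)) - Re (f t) - h * Re l) with (Re (f (t + h)%R - f t - RtoC h * l)%C)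
      by (simpl; unfold Re; ring).
    apply re_le_Cmod.
  - replace (Im (f (t + h)) - Im (f t) - h * Im l) with (Im (f (t + h)%R - f t - RtoC h * l)%C)
      by (simpl; unfold Im; ring).
    apply im_le_Cmod.
Qed.

Lemma is_cderive_0_const (f : R -> C) (T s t : R) : T < s -> T < t ->
  (forall u, T < u -> is_cderive f u 0%C) -> f s = f t.
Proof.
  assert (K : forall (g : R -> R), (forall u, T < u -> is_derive g u 0) ->
    T < s -> T < t -> g s = g t).
  { intros g Hg Hs Ht.
    assert (HT : T < Rmin s t) by now apply Rmin_case.
    destruct (MVT_gen g s t (fun _ => 0)) as [c [_ Ec]].
    - intros x Hx. apply Hg. lra.
    - intros x Hx. apply derivable_continuous_pt. exists 0. apply is_derive_Reals. apply Hg. lra.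
    - lra. }
  intros Hs Ht H. apply injective_projections.
  - apply (K (fun u => Re (f u))); auto. intros u Hu. apply (H u Hu).
  - apply (K (fun u => Im (f u))); auto. intros u Hu. apply (H u Hu).
Qed.

Lemma is_RInt_gen_exp_right0 (c : R) : 0 < c ->
  is_RInt_gen (fun s => exp (- (c * s))) right0 pinfty (/ c).
Proof.
  intros Hc.
  destruct (is_CInt_gen_derive right0 (fun s => RtoC (- / c * exp (- (c * s))))
    (fun s => RtoC (exp (- (c * s)))) (RtoC (- / c)) 0%C starts_in_right0) as [H _].
  - intros t Ht. apply is_cderive_RtoC. auto_derive; [trivial|]. field. lra.
  - intros t Ht. apply ccontinuous_RtoC. apply (ex_derive_continuous (V := R_NormedModule)).
    auto_derive. trivial.
  - apply (is_climit_right0 _ _ 1 1 Rlt_0_1). intros s Hs.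
    rewrite <- RtoC_minus, Cmod_R, !Rmult_1_l, exp_ln by lra.
    assert (Hic : 0 < / c) by now apply Rinv_0_lt_compat.
    pose proof (exp_ineq1_le (- (c * s))).
    assert (exp (- (c * s)) <= 1) by (rewrite <- exp_0; apply exp_le; nra).
    replace (- / c * exp (- (c * s)) - - / c) with (/ c * (1 - exp (- (c * s)))) by ring.
    rewrite Rabs_pos_eq by nra.
    apply (Rmult_le_reg_l c); [auto|]. rewrite <- Rmult_assoc, Rinv_r by lra. lra.
  - apply (is_climit_pinfty _ _ (/ c / c) 0). intros s _ Hs.
    replace (RtoC (- / c * exp (- (c * s))) - 0)%C with (RtoC (- / c * exp (- (c * s)))) by ring.
    assert (Hic : 0 < / c) by now apply Rinv_0_lt_compat.
    pose proof (exp_pos (- (c * s))).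
    rewrite Cmod_R, Ropp_mult_distr_l_reverse, Rabs_Ropp, Rabs_pos_eq by nra.
    unfold Rdiv. rewrite Rmult_assoc. apply Rmult_le_compat_l; [lra|].
    rewrite <- Rinv_mult, exp_Ropp. apply Rinv_le_contravar; [nra|].
    pose proof (exp_ineq1_le (c * s)). lra.
  - eapply is_RInt_gen_ext in H; [|apply filter_forall; intros [a b] x _; simpl; reflexivity].
    replace (/ c) with (Re (0 - RtoC (- / c))%C) by (simpl; ring). exact H.
Qed.

(** For [Re a > 0] and [t > 0] this is [Gamma(a) U(a, a + c + 1, t)]. With [c] as parameter instead
    of [b], differentiation in [t] only raises [a]. *)
Definition tricomi_integral (a c : C) (t : R) : C :=
  CInt_gen (fun s => RtoC (exp (- (t * s))) * (Rcpow s (a - 1) * Rcpow (1 + s) c))%C right0 pinfty.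

Lemma ccontinuous_Rcpow_1plus (s : R) (c : C) : 0 < s -> ccontinuous (fun s => Rcpow (1 + s) c) s.
Proof.
  intros Hs. eapply is_cderive_continuous.
  apply (is_cderive_comp (fun u => Rcpow u c) (fun s => 1 + s)).
  - apply is_cderive_Rcpow. lra.
  - auto_derive; [trivial|reflexivity].
Qed.

Lemma Cmod_beta_kernel (a c : C) (s : R) :
  Cmod (Rcpow s (a - 1) * Rcpow (1 + s) c)%C = exp ((Re a - 1) * ln s + Re c * ln (1 + s)).
Proof. rewrite Cmod_mult, !Cmod_Rcpow, <- exp_plus. reflexivity. Qed.

Lemma tricomi_integral_param (a c : C) (t : R) : 0 < Re a -> 0 < t ->
  is_CInt_gen (fun s => RtoC (exp (- (t * s))) * (Rcpow s (a - 1) * Rcpow (1 + s) c))%C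
    right0 pinfty (tricomi_integral a c t) /\
  is_cderive (tricomi_integral a c) t (- tricomi_integral (a + 1) c t)%C.
Proof.
  intros Ha Ht.
  (* The parameter is [-t]; the margin [2 d = t / 2] leaves the decay [e^(-t s / 2)]. *)
  destruct (CInt_gen_quadratic_remainder (fun s => s) (fun s => Rcpow s (a - 1) * Rcpow (1 + s) c)%C
    (RtoC (- t)) (t / 4) 1 (Re a) (Re c) (t / 2)) as [H1 [H2 [M H3]]]; try lra.
  - intros s _. apply continuous_id.
  - intros s Hs. apply ccontinuous_mult; [now apply ccontinuous_Rcpow | now apply ccontinuous_Rcpow_1plus].
  - intros s Hs. rewrite Cmod_beta_kernel, <- exp_plus, Rmult_1_l. apply exp_le.
    rewrite Rabs_pos_eq by lra. simpl. lra.
  - assert (EC : forall u s, Cexp (RtoC (- u) * RtoC s) = RtoC (exp (- (u * s)))).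
    { intros u s. rewrite <- RtoC_mult, Cexp_RtoC. f_equal. f_equal. ring. }
    assert (E : forall h, Rabs h <= t / 4 ->
      is_CInt_gen (fun s => RtoC (exp (- ((t + h) * s))) * (Rcpow s (a - 1) * Rcpow (1 + s) c))%C
        right0 pinfty (tricomi_integral a c (t + h)) /\
      CInt_gen (fun s => Cexp (RtoC (- (t + h)) * RtoC s) * (Rcpow s (a - 1) * Rcpow (1 + s) c))%C
        right0 pinfty = tricomi_integral a c (t + h)).
    { intros h Hh. specialize (H1 (RtoC (- (t + h)))).
      replace (RtoC (- (t + h)) - RtoC (- t))%C with (RtoC (- h)) in H1
        by (rewrite <- RtoC_minus; f_equal; ring).
      rewrite Cmod_R, Rabs_Ropp in H1. specialize (H1 Hh).
      apply (is_CInt_gen_ext right0 (fun s => 0 < s) _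
        (fun s => RtoC (exp (- ((t + h) * s))) * (Rcpow s (a - 1) * Rcpow (1 + s) c))%C) in H1.
      - pose proof (is_CInt_gen_unique _ right0 pinfty _ H1) as E. split.
        + unfold tricomi_integral. rewrite E. exact H1.
        + symmetry. exact E.
      - apply starts_in_right0.
      - intros s Hs. now rewrite EC. }
    assert (E0 := E 0). rewrite Rplus_0_r, Rabs_R0 in E0. destruct (E0 ltac:(lra)) as [E1 E2].
    split; [exact E1|].
    apply (quadratic_is_cderive _ _ _ (t / 4) M); [lra|]. intros h Hh.
    specialize (H3 (RtoC (- (t + h)))).
    replace (RtoC (- (t + h)) - RtoC (- t))%C with (RtoC (- h)) in H3
        by (rewrite <- RtoC_minus; f_equal; ring).
    rewrite Cmod_R, Rabs_Ropp in H3. specialize (H3 Hh).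
    rewrite (proj2 (E h Hh)), E2 in H3.
    apply (is_CInt_gen_ext right0 (fun s => 0 < s) _
        (fun s => RtoC (exp (- (t * s))) * (Rcpow s (a + 1 - 1) * Rcpow (1 + s) c))%C) in H2.
    + apply (is_CInt_gen_unique _ right0 pinfty) in H2. unfold tricomi_integral at 3. rewrite H2.
      replace (h * h) with (Rabs h * Rabs h) by (rewrite <- Rabs_mult; apply Rabs_pos_eq; nra).
      eapply Rle_trans; [|exact H3]. right. f_equal. rewrite (RtoC_opp h). ring.
    + apply starts_in_right0.
    + intros s Hs. rewrite EC. replace (a + 1 - 1)%C with ((a - 1) + 1)%C by ring.
      rewrite Rcpow_plus1 by auto. ring.
Qed.

Lemma tricomi_integral_correct (a c : C) (t : R) : 0 < Re a -> 0 < t ->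
  is_CInt_gen (fun s => RtoC (exp (- (t * s))) * (Rcpow s (a - 1) * Rcpow (1 + s) c))%C
    right0 pinfty (tricomi_integral a c t).
Proof. intros Ha Ht. apply (tricomi_integral_param a c t Ha Ht). Qed.

Lemma is_cderive_tricomi_integral (a c : C) (t : R) : 0 < Re a -> 0 < t ->
  is_cderive (tricomi_integral a c) t (- tricomi_integral (a + 1) c t)%C.
Proof. intros Ha Ht. apply (tricomi_integral_param a c t Ha Ht). Qed.

Lemma Re_plus1 (a : C) : Re (a + 1)%C = Re a + 1.
Proof. reflexivity. Qed.

Lemma tricomi_integral_succ_r (a c : C) (t : R) : 0 < Re a -> 0 < t ->
  tricomi_integral a (c + 1) t = (tricomi_integral a c t + tricomi_integral (a + 1) c t)%C.
Proof.
  intros Ha Ht. apply (is_CInt_gen_unique _ right0 pinfty).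
  eapply (is_CInt_gen_ext right0 (fun s => 0 < s)); [apply starts_in_right0| |
    exact (is_CInt_gen_plus right0 pinfty _ _ _ _ (tricomi_integral_correct a c t Ha Ht)
      (tricomi_integral_correct (a + 1) c t ltac:(rewrite Re_plus1; lra) Ht))].
  intros s Hs. cbv beta. replace (a + 1 - 1)%C with ((a - 1) + 1)%C by ring.
  rewrite !Rcpow_plus1 by lra. rewrite RtoC_plus. ring.
Qed.

(** [e^(-t s) s^a (1 + s)^(c + 1)] vanishes at both ends, so its derivative integrates to 0. *)
Lemma tricomi_integral_by_parts (a c : C) (t : R) : 0 < Re a -> 0 < t ->
  (RtoC t * tricomi_integral (a + 1) (c + 1) t =
   a * tricomi_integral a (c + 1) t + (c + 1) * tricomi_integral (a + 1) c t)%C.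
Proof.
  intros Ha Ht.
  assert (Ha1 : 0 < Re (a + 1)%C) by (rewrite Re_plus1; lra).
  set (F := fun s => (RtoC (exp (- (t * s))) * (Rcpow s a * Rcpow (1 + s) (c + 1)))%C).
  set (k := fun a c s => (RtoC (exp (- (t * s))) * (Rcpow s (a - 1) * Rcpow (1 + s) c))%C).
  set (f := fun s => (a * k a (c + 1) s + (c + 1) * k (a + 1) c s - RtoC t * k (a + 1) (c + 1) s)%C).
  assert (Hf : is_CInt_gen f right0 pinfty
    (a * tricomi_integral a (c + 1) t + (c + 1) * tricomi_integral (a + 1) c t
     - RtoC t * tricomi_integral (a + 1) (c + 1) t)%C).
  { apply (is_CInt_gen_minus right0 pinfty); [apply (is_CInt_gen_plus right0 pinfty)|];
    apply (is_CInt_gen_scal right0 pinfty); now apply tricomi_integral_correct. }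
  assert (Hk : forall a c s, 0 < s -> ccontinuous (k a c) s).
  { intros a' c' s Hs. apply ccontinuous_mult.
    - apply ccontinuous_RtoC. apply (ex_derive_continuous (V := R_NormedModule)). auto_derive. trivial.
    - apply ccontinuous_mult; [now apply ccontinuous_Rcpow | now apply ccontinuous_Rcpow_1plus]. }
  destruct (is_climit_boundary F 1 (Re a) (Re c + 1) t) as [L0 L1]; try lra.
  { intros s Hs. unfold F. rewrite !Cmod_mult, !Cmod_Rcpow, Cmod_R, Rabs_pos_eq by (left; apply exp_pos).
    rewrite <- !exp_plus, Rmult_1_l. apply exp_le. rewrite Re_plus1. right; ring. }
  assert (HF : is_CInt_gen f right0 pinfty (0 - 0)%C).
  { apply (is_CInt_gen_derive right0 F f); auto using starts_in_right0.
    - intros s Hs. eapply is_cderive_value.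
      + apply is_cderive_mult.
        * apply is_cderive_RtoC. auto_derive; [trivial|reflexivity].
        * apply is_cderive_mult; [now apply is_cderive_Rcpow|].
          apply (is_cderive_comp (fun u => Rcpow u (c + 1)) (fun s => 1 + s)).
          -- apply is_cderive_Rcpow. lra.
          -- auto_derive; [trivial|reflexivity].
      + unfold f, k. replace (a + 1 - 1)%C with a by ring. replace (c + 1 - 1)%C with c by ring.
        rewrite Rmult_1_r, RtoC_mult, RtoC_opp. ring.
    - intros s Hs. apply ccontinuous_minus; [apply ccontinuous_plus|]; apply ccontinuous_scal; auto. }
  apply (is_CInt_gen_unique _ right0 pinfty) in Hf. apply (is_CInt_gen_unique _ right0 pinfty) in HF.
  rewrite HF in Hf.
  set (A := (a * _ + _)%C) in *.
  transitivity (A - (A - RtoC t * tricomi_integral (a + 1) (c + 1) t))%C; [ring|].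
  rewrite <- Hf. ring.
Qed.

(** Integration by parts with [c + 1 = b - a], once [(1 + s)^(c + 1)] is expanded as
    [(1 + s)^c + s (1 + s)^c]. *)
Lemma tricomi_integral_kummer (a b : C) (t : R) : 0 < Re a -> 0 < t ->
  let c := (b - a - 1)%C in
  (RtoC t * tricomi_integral (a + 1 + 1) c t + (b - RtoC t) * - tricomi_integral (a + 1) c t
   - a * tricomi_integral a c t = 0)%C.
Proof.
  intros Ha Ht c.
  pose proof (tricomi_integral_by_parts a c t Ha Ht) as H.
  rewrite !tricomi_integral_succ_r in H by (rewrite ?Re_plus1; lra).
  set (I2 := tricomi_integral (a + 1 + 1) c t) in *. set (I1 := tricomi_integral (a + 1) c t) in *.
  set (I0 := tricomi_integral a c t) in *.
  transitivity (RtoC t * (I1 + I2) - (a * (I0 + I1) + (c + 1) * I1))%C; [unfold c; ring|].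
  rewrite H. ring.
Qed.

(** In place of the substitution [u = t s], the left side is shown to have derivative 0 in [t]; at
    [t = 1] it is Euler's integral. *)
Lemma tricomi_integral_scaling (a : C) (t : R) : 0 < Re a -> 0 < t ->
  (Rcpow t a * tricomi_integral a 0 t)%C = CGamma a.
Proof.
  intros Ha Ht.
  transitivity (Rcpow 1 a * tricomi_integral a 0 1)%C.
  - apply (is_cderive_0_const (fun t => Rcpow t a * tricomi_integral a 0 t)%C 0); auto; [lra|].
    intros u Hu. eapply is_cderive_value.
    + apply is_cderive_mult; [now apply is_cderive_Rcpow|]. now apply is_cderive_tricomi_integral.
    (* At [c = -1] the last term drops out and [c + 1 = 0], so the integral for [a + 1] is [a / u]
       times that for [a]. *)
    + pose proof (tricomi_integral_by_parts a (- (1)) u Ha Hu) as H.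
      replace (- (1) + 1)%C with (RtoC 0) in H by ring.
      rewrite Rcpow_minus1 by auto.
      assert (Hu0 : RtoC u <> 0%C) by (apply RtoC_neq0; lra).
      replace (tricomi_integral (a + 1) 0 u) with (a * tricomi_integral a 0 u / RtoC u)%C.
      * field. auto.
      * replace (a * tricomi_integral a 0 u)%C with (RtoC u * tricomi_integral (a + 1) 0 u)%C.
        -- field. auto.
        -- rewrite H. ring.
  - unfold Rcpow at 1. rewrite ln_1, Cmult_0_r, Cexp_0, Cmult_1_l.
    symmetry. apply (is_CInt_gen_unique _ right0 pinfty).
    eapply (is_CInt_gen_ext right0 (fun s => 0 < s)); [apply starts_in_right0| |
      exact (tricomi_integral_correct a 0 1 Ha Rlt_0_1)].
    intros s Hs. cbv beta. rewrite Rcpow_0, Rmult_1_l. ring.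
Qed.

Lemma Cmod_Cexp_sub1_le (w : C) : Cmod (Cexp w - 1)%C <= 3 * Cmod w * exp (2 * Cmod w).
Proof.
  pose proof (Cmod_Cexp_sub_le w) as H. set (m := Cmod w) in *.
  assert (Hm : 0 <= m) by apply Cmod_ge_0.
  replace (Cexp w - 1)%C with ((Cexp w - 1 - w) + w)%C by ring.
  eapply Rle_trans; [apply Cmod_triangle|]. fold m.
  replace (2 * m) with (m + m) by ring. rewrite exp_plus.
  pose proof (exp_ineq1_le m) as Hg.
  assert (1 <= exp m) by lra. assert (m <= exp m) by lra.
  assert (1 <= exp m * exp m) by nra.
  assert (exp m * m <= exp m * exp m) by (apply Rmult_le_compat_l; lra).
  nra.
Qed.

(** By scaling, the limit is the exact value for [c = 0]. The difference carries [(1 + s)^c - 1],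
    which vanishes to first order at 0, and this extra factor [s] gains a factor [1 / t]. *)
Lemma tricomi_integral_asymptotic (a c : C) : 0 < Re a ->
  is_climit (fun t => Rcpow t a * tricomi_integral a c t)%C pinfty (CGamma a).
Proof.
  intros Ha.
  (* [K1] absorbs a power of [1 + s] into [e^s], and [K2] absorbs [(t s)^(Re a)] into [e^(t s / 2)].
     For [t > 4] the remaining exponent [s - t s / 2] is at most [- t s / 4]. *)
  destruct (ln1p_linear_bound (2 * Cmod c) 1 Rlt_0_1) as [K1 HK1].
  destruct (ln1p_linear_bound (Re a) (/ 2) ltac:(lra)) as [K2 HK2].
  set (K := 3 * Cmod c * exp (K1 + K2)).
  assert (HK : 0 <= K).
  { unfold K. pose proof (exp_pos (K1 + K2)). pose proof (Cmod_ge_0 c). nra. }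
  apply (is_climit_pinfty _ _ (2 * (4 * K)) 4). intros t Ht4 Ht.
  rewrite <- (tricomi_integral_scaling a t Ha Ht).
  replace (2 * (4 * K) / t) with (2 * (K * / (t / 4))) by (field; lra).
  apply (is_CInt_gen_Cmod_le right0 (fun s => 0 < s)
    (fun s => Rcpow t a * (RtoC (exp (- (t * s))) * (Rcpow s (a - 1) * Rcpow (1 + s) c))
      - Rcpow t a * (RtoC (exp (- (t * s))) * (Rcpow s (a - 1) * Rcpow (1 + s) 0)))%C
    (fun s => K * exp (- (t / 4 * s)))).
  - apply starts_in_right0.
  - intros s Hs. rewrite Rcpow_0.
    replace (_ - _)%C with (Rcpow t a * (RtoC (exp (- (t * s))) * Rcpow s (a - 1)) * (Rcpow (1 + s) c - 1))%C by ring.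
    rewrite !Cmod_mult, !Cmod_Rcpow, Cmod_R, Rabs_pos_eq by (left; apply exp_pos).
    rewrite <- !exp_plus.
    pose proof (ln1p_ge0 s Hs) as Hu0. set (u := ln (1 + s)) in *.
    assert (Hus : u <= s) by (unfold u; pose proof (ln_le_sub1 (1 + s)); lra).
    assert (Hw : Cmod (Rcpow (1 + s) c - 1)%C <= 3 * Cmod c * exp (ln s + (K1 + s))).
    { unfold Rcpow. fold u. eapply Rle_trans; [apply Cmod_Cexp_sub1_le|].
      rewrite Cmod_mult, Cmod_R, Rabs_pos_eq by auto.
      rewrite exp_plus, exp_ln by auto.
      pose proof (Cmod_ge_0 c). pose proof (HK1 s Hs) as H1. fold u in H1.
      apply Rle_trans with (3 * Cmod c * (u * exp (2 * (Cmod c * u)))); [right; ring|].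
      apply Rmult_le_compat_l; [lra|]. apply Rmult_le_compat; auto.
      - left; apply exp_pos.
      - apply exp_le. lra. }
    eapply Rle_trans; [apply Rmult_le_compat_l; [left; apply exp_pos | exact Hw]|].
    unfold K.
    replace (exp (Re a * ln t + (- (t * s) + Re (a - 1) * ln s)) * (3 * Cmod c * exp (ln s + (K1 + s))))
      with (3 * Cmod c * (exp (Re a * ln t + (- (t * s) + Re (a - 1) * ln s)) * exp (ln s + (K1 + s)))) by ring.
    rewrite (Rmult_assoc (3 * Cmod c) (exp (K1 + K2))). rewrite <- !exp_plus.
    apply Rmult_le_compat_l; [pose proof (Cmod_ge_0 c); lra|]. apply exp_le.
    replace (Re (a - 1)%C) with (Re a - 1) by reflexivity.
    assert (Hts : 0 < t * s) by nra.
    pose proof (HK2 (t * s) Hts) as H2.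
    assert (H3 : ln (t * s) <= ln (1 + t * s)) by (left; apply ln_increasing; lra).
    rewrite ln_mult in H3 by auto.
    assert (Re a * (ln t + ln s) <= Re a * ln (1 + t * s)) by (apply Rmult_le_compat_l; lra).
    nra.
  - apply (is_CInt_gen_minus right0 pinfty); apply (is_CInt_gen_scal right0 pinfty);
      now apply tricomi_integral_correct.
  - assert (Ht0 : 0 < t / 4) by lra.
    apply (is_RInt_gen_scal _ K _ (is_RInt_gen_exp_right0 (t / 4) Ht0)).
Qed.

Lemma is_climit_filterlim (f : R -> C) (F : (R -> Prop) -> Prop) {FF : Filter F} (l : C) :
  is_climit f F l <-> filterlim f F (locally l).
Proof.
  split.
  - intros H. apply (filterlim_locally (U := C_UniformSpace)). intros eps.
    eapply filter_imp; [|exact (H eps)]. intros t Ht.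
    apply C_NormedModule_mixin_compat1. exact Ht.
  - intros H eps.
    (* A product ball of radius [r] only bounds the modulus by [sqrt 2 r]; halving suffices as
       [sqrt 2 < 2]. *)
    assert (He : 0 < eps / 2) by (destruct eps; simpl; lra).
    pose proof (proj1 (filterlim_locally (U := C_UniformSpace) _ _) H (mkposreal _ He)) as K.
    eapply filter_imp; [|exact K]. intros t Ht. apply C_NormedModule_mixin_compat2 in Ht.
    assert (E : Cmod (f t - l)%C < sqrt 2 * (eps / 2)) by exact Ht.
    assert (sqrt 2 < 2).
    { rewrite <- (sqrt_Rsqr 2) at 2 by lra. apply sqrt_lt_1; unfold Rsqr; lra. }
    destruct eps; simpl in *; nra.
Qed.

Lemma is_tricomi_integral (a b : C) : 0 < Re a ->
  is_tricomi a b (fun t => tricomi_integral a (b - a - 1) t / CGamma a)%C.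
Proof.
  intros Ha. set (c := (b - a - 1)%C).
  assert (HG := CGamma_neq0 a Ha).
  assert (Ha1 : 0 < Re (a + 1)%C) by (rewrite Re_plus1; lra).
  split.
  - exists (fun t => / CGamma a * (- (1) * tricomi_integral (a + 1) c t))%C,
      (fun t => / CGamma a * (- (1) * - tricomi_integral (a + 1 + 1) c t))%C.
    intros t Ht. split; [|split].
    + apply is_cderive_is_derive. eapply is_cderive_ext; [intros s; apply Cmult_comm|].
      eapply is_cderive_value.
      * apply is_cderive_scal. now apply is_cderive_tricomi_integral.
      * ring.
    + apply is_cderive_is_derive. apply is_cderive_scal, is_cderive_scal.
      now apply is_cderive_tricomi_integral.
    + pose proof (tricomi_integral_kummer a b t Ha Ht) as H. cbv zeta in H. fold c in H.
      transitivity (/ CGamma a * (RtoC t * tricomi_integral (a + 1 + 1) c t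
        + (b - RtoC t) * - tricomi_integral (a + 1) c t - a * tricomi_integral a c t))%C.
      * field. auto.
      * rewrite H. ring.
  - apply is_climit_filterlim; [apply Rbar_locally_filter|].
    intros eps.
    assert (Hg : 0 < Cmod (CGamma a)) by now apply Cmod_gt_0.
    assert (He : 0 < eps * Cmod (CGamma a)) by (apply Rmult_lt_0_compat; [apply cond_pos|auto]).
    eapply filter_imp; [|exact (tricomi_integral_asymptotic a c Ha (mkposreal _ He))].
    intros t Ht. simpl in Ht.
    replace (Rcpow t a * (tricomi_integral a c t / CGamma a) - 1)%C
      with ((Rcpow t a * tricomi_integral a c t - CGamma a) / CGamma a)%C by (field; auto).
    rewrite Cmod_div by auto. apply (Rmult_lt_reg_r (Cmod (CGamma a))); [auto|].
    unfold Rdiv. rewrite Rmult_assoc, Rinv_l, Rmult_1_r by lra. exact Ht.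
Qed.

(** * Uniqueness of Tricomi's function *)

Lemma is_cderive_inv (f : R -> C) (t : R) (l : C) : f t <> 0%C ->
  is_cderive f t l -> is_cderive (fun t => / f t)%C t (- l / (f t * f t))%C.
Proof.
  intros H0 [H1 H2].
  assert (Hn : Re (f t) * Re (f t) + Im (f t) * Im (f t) <> 0).
  { intros E. apply H0. apply injective_projections; simpl; unfold Re, Im in E; nra. }
  set (N := fun t => Re (f t) * Re (f t) + Im (f t) * Im (f t)).
  assert (HN : is_derive N t (2 * (Re (f t) * Re l + Im (f t) * Im l))).
  { eapply is_derive_value.
    - exact (is_derive_plus _ _ _ _ _ (is_derive_Rmult _ _ _ _ _ H1 H1)
        (is_derive_Rmult _ _ _ _ _ H2 H2)).
    - unfold plus; simpl. ring. }
  assert (Hn2 : fst (f t) ^ 2 + snd (f t) ^ 2 <> 0) by (unfold Re, Im in Hn; simpl; rewrite !Rmult_1_r; exact Hn).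
  assert (Hn3 : (fst (f t) * fst (f t) - snd (f t) * snd (f t)) ^ 2
      + (fst (f t) * snd (f t) + snd (f t) * fst (f t)) ^ 2 <> 0).
  { replace (_ + _) with ((fst (f t) ^ 2 + snd (f t) ^ 2) ^ 2) by ring. now apply pow_nonzero. }
  split.
  - apply (is_derive_ext (fun t => Re (f t) / N t)).
    + intros s. unfold N. simpl. unfold Re, Im. now rewrite !Rmult_1_r.
    + eapply is_derive_value; [exact (is_derive_div _ _ _ _ _ H1 HN Hn)|].
      unfold N. simpl. unfold Re, Im in *. field. simpl in *. lra.
  - apply (is_derive_ext (fun t => - Im (f t) / N t)).
    + intros s. unfold N. simpl. unfold Re, Im. now rewrite !Rmult_1_r.
    + eapply is_derive_value; [exact (is_derive_div _ _ _ _ _ (is_derive_opp _ _ _ H2) HN Hn)|].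
      unfold N. simpl. unfold Re, Im, opp in *; simpl in *. field. lra.
Qed.

(** The increment of [g] over [t, t + 1] tends to 0, yet it is a value of [g1] beyond [t], hence
    tends to [l]. *)
Lemma is_derive_limit_0 (g g1 : R -> R) (l T : R) :
  (forall t, T < t -> is_derive g t (g1 t)) ->
  filterlim g pinfty (locally 0) -> filterlim g1 pinfty (locally l) -> l = 0.
Proof.
  intros Hd H0 H1. destruct (Req_dec l 0) as [|Hl]; [assumption|exfalso].
  assert (He : 0 < Rabs l / 4) by (pose proof (Rabs_pos_lt l Hl); lra).
  destruct (proj1 (filterlim_locally (U := R_UniformSpace) _ _) H0 (mkposreal _ He)) as [T0 K0].
  destruct (proj1 (filterlim_locally (U := R_UniformSpace) _ _) H1 (mkposreal _ He)) as [T1 K1].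
  set (t := Rmax T (Rmax T0 T1) + 1).
  pose proof (Rmax_l T (Rmax T0 T1)). pose proof (Rmax_r T (Rmax T0 T1)).
  pose proof (Rmax_l T0 T1). pose proof (Rmax_r T0 T1).
  destruct (MVT_gen g t (t + 1) g1) as [c [Hc Ec]].
  - intros x Hx. apply Hd. rewrite Rmin_left in Hx by lra. unfold t in *; lra.
  - intros x Hx. apply derivable_continuous_pt. exists (g1 x). apply is_derive_Reals. apply Hd.
    rewrite Rmin_left in Hx by lra. unfold t in *; lra.
  - rewrite Rmin_left in Hc by lra.
    assert (B0 : Rabs (g t - 0) < Rabs l / 4) by (apply K0; unfold t; lra).
    assert (B1 : Rabs (g (t + 1) - 0) < Rabs l / 4) by (apply K0; unfold t; lra).
    assert (B2 : Rabs (g1 c - l) < Rabs l / 4) by (apply K1; unfold t in *; lra).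
    clear K0 K1; revert B0 B1 B2 He Hl Ec. unfold Rabs. repeat destruct Rcase_abs; intros; lra.
Qed.

Lemma is_cderive_climit_0 (g g1 : R -> C) (l : C) (T : R) :
  (forall t, T < t -> is_cderive g t (g1 t)) ->
  is_climit g pinfty 0%C -> is_climit g1 pinfty l -> l = 0%C.
Proof.
  intros Hd H0 H1.
  destruct (is_climit_parts g pinfty 0%C H0) as [A0 B0].
  destruct (is_climit_parts g1 pinfty l H1) as [A1 B1].
  apply injective_projections.
  - apply (is_derive_limit_0 (fun t => Re (g t)) (fun t => Re (g1 t)) _ T); auto.
    intros t Ht. apply (Hd t Ht).
  - apply (is_derive_limit_0 (fun t => Im (g t)) (fun t => Im (g1 t)) _ T); auto.
    intros t Ht. apply (Hd t Ht).
Qed.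

Lemma inner_ge (x y : C) : - (Cmod x * Cmod y) <= Re x * Re y + Im x * Im y.
Proof.
  rewrite <- (Cmod_conj x), <- Cmod_mult.
  replace (Re x * Re y + Im x * Im y) with (Re (Cconj x * y)%C) by (simpl; unfold Re, Im; ring).
  pose proof (re_le_Cmod (Cconj x * y)%C) as H. pose proof (Rle_abs (- Re (Cconj x * y)%C)).
  rewrite Rabs_Ropp in *. lra.
Qed.

(* A Gronwall estimate, run backwards from [T], on [|d|^2 + |d'|^2]. *)
Lemma linear_ode2_backward_unique (d d1 d2 : R -> C) (A B : R) (t T : R) : t <= T ->
  0 <= A -> 0 <= B ->
  (forall s, t <= s <= T -> is_cderive d s (d1 s) /\ is_cderive d1 s (d2 s) /\
     Cmod (d2 s) <= A * Cmod (d s) + B * Cmod (d1 s)) ->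
  d T = 0%C -> d1 T = 0%C -> d t = 0%C.
Proof.
  intros HtT HA HB H HT HT1.
  set (E := fun s => Re (d s) * Re (d s) + Im (d s) * Im (d s)
      + (Re (d1 s) * Re (d1 s) + Im (d1 s) * Im (d1 s))).
  set (E1 := fun s => 2 * (Re (d s) * Re (d1 s) + Im (d s) * Im (d1 s)
      + (Re (d1 s) * Re (d2 s) + Im (d1 s) * Im (d2 s)))).
  (* Chosen so that [E' >= - K E], by [2 x y <= x^2 + y^2]; then [E e^(K s)] is nondecreasing and
     vanishes at [T]. *)
  set (K := 1 + A + 2 * B).
  assert (HE : forall s, t <= s <= T -> is_derive E s (E1 s)).
  { intros s Hs. destruct (H s Hs) as [[H1 H2] [[H3 H4] _]].
    eapply is_derive_value.
    - exact (is_derive_plus _ _ _ _ _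
        (is_derive_plus _ _ _ _ _ (is_derive_Rmult _ _ _ _ _ H1 H1) (is_derive_Rmult _ _ _ _ _ H2 H2))
        (is_derive_plus _ _ _ _ _ (is_derive_Rmult _ _ _ _ _ H3 H3) (is_derive_Rmult _ _ _ _ _ H4 H4))).
    - unfold E1, plus; simpl. ring. }
  set (F := fun s => E s * exp (K * s)).
  assert (HF : forall s, t <= s <= T -> is_derive F s ((E1 s + K * E s) * exp (K * s))).
  { intros s Hs. eapply is_derive_value.
    - apply is_derive_Rmult; [now apply HE|]. auto_derive; [trivial|reflexivity].
    - cbv beta. ring. }
  assert (Hpos : forall s, t <= s <= T -> 0 <= E1 s + K * E s).
  { intros s Hs. destruct (H s Hs) as [_ [_ Hd2]].
    assert (EE : E s = Cmod (d s) * Cmod (d s) + Cmod (d1 s) * Cmod (d1 s)).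
    { pose proof (Cmod2_alt (d s)). pose proof (Cmod2_alt (d1 s)). unfold E. simpl in *. lra. }
    pose proof (inner_ge (d s) (d1 s)) as I1. pose proof (inner_ge (d1 s) (d2 s)) as I2.
    rewrite EE. unfold E1, K.
    pose proof (Cmod_ge_0 (d s)). pose proof (Cmod_ge_0 (d1 s)).
    set (x := Cmod (d s)) in *. set (y := Cmod (d1 s)) in *.
    assert (I3 : y * Cmod (d2 s) <= y * (A * x + B * y)) by (apply Rmult_le_compat_l; auto).
    assert (0 <= (x - y) * (x - y)) by apply Rle_0_sqr.
    assert (0 <= A * ((x - y) * (x - y))) by (apply Rmult_le_pos; auto).
    assert (0 <= B * (x * x)) by (apply Rmult_le_pos; nra). nra. }
  destruct (MVT_gen F t T (fun s => (E1 s + K * E s) * exp (K * s))) as [c [Hc Ec]].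
  - intros s Hs. rewrite Rmin_left, Rmax_right in Hs by lra. apply HF; lra.
  - intros s Hs. rewrite Rmin_left, Rmax_right in Hs by lra.
    apply derivable_continuous_pt. eexists. apply is_derive_Reals. apply HF; lra.
  - rewrite Rmin_left, Rmax_right in Hc by lra.
    assert (HFT : F T = 0).
    { unfold F, E. rewrite HT, HT1. simpl. ring. }
    assert (HFt : F t <= 0).
    { assert (0 <= (E1 c + K * E c) * exp (K * c) * (T - t)).
      { apply Rmult_le_pos; [|lra]. apply Rmult_le_pos; [auto|left; apply exp_pos]. }
      lra. }
    unfold F in HFt. pose proof (exp_pos (K * t)).
    assert (HEt : E t <= 0) by nra. unfold E in HEt.
    apply injective_projections; simpl; unfold Re, Im in HEt; nra.
Qed.

(** The asymptotics concern [w] and [v] but not their derivatives, so the Wronskian cannot be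
    estimated directly. It enters through [(d / v)' = - W / v^2] with [d = w - v]: multiplied by a
    power of [t] and [e^(-t)], the quotient [d / v] tends to 0 while the derivative of the product
    tends to minus Abel's constant, which is therefore 0. Then [d / v] is constant near +oo, and
    this constant is 0 because [t^a d] tends to 0 and [t^a v] to 1. *)
Lemma is_tricomi_unique (a b : C) (w v : R -> C) (t : R) :
  is_tricomi a b w -> is_tricomi a b v -> 0 < t -> w t = v t.
Proof.
  intros [[w1 [w2 Hw]] Lw] [[v1 [v2 Hv]] Lv] Ht.
  apply is_climit_filterlim in Lw; [|apply Rbar_locally_filter].
  apply is_climit_filterlim in Lv; [|apply Rbar_locally_filter].
  set (d := fun s => (w s - v s)%C). set (d1 := fun s => (w1 s - v1 s)%C).
  set (d2 := fun s => (w2 s - v2 s)%C).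
  assert (Hd : forall s, 0 < s -> is_cderive d s (d1 s)).
  { intros s Hs. apply is_cderive_minus; apply is_cderive_is_derive;
    [apply (Hw s Hs) | apply (Hv s Hs)]. }
  assert (Hd1 : forall s, 0 < s -> is_cderive d1 s (d2 s)).
  { intros s Hs. apply is_cderive_minus; apply is_cderive_is_derive;
    [apply (Hw s Hs) | apply (Hv s Hs)]. }
  assert (Hv' : forall s, 0 < s -> is_cderive v s (v1 s)).
  { intros s Hs. apply is_cderive_is_derive. apply (Hv s Hs). }
  assert (Hv1' : forall s, 0 < s -> is_cderive v1 s (v2 s)).
  { intros s Hs. apply is_cderive_is_derive. apply (Hv s Hs). }
  assert (Hnz : forall s, 0 < s -> RtoC s <> 0%C) by (intros s Hs; apply RtoC_neq0; lra).
  assert (Ev2 : forall s, 0 < s -> v2 s = ((a * v s - (b - RtoC s) * v1 s) / RtoC s)%C).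
  { intros s Hs. destruct (Hv s Hs) as [_ [_ E]].
    assert (E' : (RtoC s * v2 s)%C = (a * v s - (b - RtoC s) * v1 s)%C).
    { transitivity (RtoC s * v2 s + (b - RtoC s) * v1 s - a * v s
        + (a * v s - (b - RtoC s) * v1 s))%C; [ring|]. rewrite E. ring. }
    rewrite <- E'. field. auto. }
  assert (Ed2 : forall s, 0 < s -> d2 s = ((a * d s - (b - RtoC s) * d1 s) / RtoC s)%C).
  { intros s Hs. unfold d2. rewrite (Ev2 s Hs). destruct (Hw s Hs) as [_ [_ E]].
    assert (E' : (RtoC s * w2 s)%C = (a * w s - (b - RtoC s) * w1 s)%C).
    { transitivity (RtoC s * w2 s + (b - RtoC s) * w1 s - a * w s
        + (a * w s - (b - RtoC s) * w1 s))%C; [ring|]. rewrite E. ring. }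
    replace (w2 s) with ((a * w s - (b - RtoC s) * w1 s) / RtoC s)%C.
    - unfold d, d1. field. auto.
    - rewrite <- E'. field. auto. }
  (* Abel's identity *)
  set (W := fun s => (d s * v1 s - d1 s * v s)%C).
  set (P := fun s => (Rcpow s b * (RtoC (exp (- s)) * W s))%C).
  assert (HP : forall s, 0 < s -> is_cderive P s 0%C).
  { intros s Hs. eapply is_cderive_value.
    - apply is_cderive_mult; [now apply is_cderive_Rcpow|]. apply is_cderive_mult.
      + apply is_cderive_RtoC. auto_derive; [trivial|reflexivity].
      + apply is_cderive_minus; apply is_cderive_mult; auto.
    - rewrite (Ev2 s Hs), (Ed2 s Hs), Rcpow_minus1 by auto. unfold W.
      replace (- (1) * exp (- s)) with (- exp (- s)) by ring. rewrite RtoC_opp. field. auto. }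
  set (k := P 1).
  assert (HPk : forall s, 0 < s -> P s = k).
  { intros s Hs. apply (is_cderive_0_const P 0); auto; lra. }
  set (x := fun s => (Rcpow s a * d s)%C). set (y := fun s => (Rcpow s a * v s)%C).
  assert (Lx : is_climit x pinfty 0%C).
  { intros eps. assert (He : 0 < eps / 2) by (destruct eps; simpl; lra).
    eapply filter_imp; [|exact (filter_and _ _ (Lw (mkposreal _ He)) (Lv (mkposreal _ He)))].
    intros s [Q1 Q2]. simpl in Q1, Q2.
    replace (x s - 0)%C with ((Rcpow s a * w s - 1) + - (Rcpow s a * v s - 1))%C by (unfold x, d; ring).
    eapply Rle_lt_trans; [apply Cmod_triangle|]. rewrite Cmod_opp. lra. }
  (* Beyond [T] the normalised solution [y] stays within 1/2 of 1, so [v] has no zero there;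
     [T >= 1] keeps [ln s] nonnegative. *)
  destruct (Lv (mkposreal (/ 2) ltac:(lra))) as [T0 HT0]. simpl in HT0.
  set (T := Rmax T0 1).
  assert (HT : 1 <= T) by apply Rmax_r.
  assert (HTy : forall s, T < s -> Cmod (y s - 1)%C < / 2 /\ / 2 <= Cmod (y s) <= 3 / 2).
  { intros s Hs. assert (Hy : Cmod (y s - 1)%C < / 2).
    { apply HT0. pose proof (Rmax_l T0 1). unfold T in Hs. lra. }
    split; [exact Hy|]. split.
    - assert (1 <= Cmod (y s) + Cmod (- (y s - 1))%C).
      { rewrite <- Cmod_1 at 1. replace (RtoC 1) with (y s + - (y s - 1))%C at 1 by ring.
        apply Cmod_triangle. }
      rewrite Cmod_opp in *. lra.
    - replace (y s) with ((y s - 1) + 1)%C by ring.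
      eapply Rle_trans; [apply Cmod_triangle|]. rewrite Cmod_1. lra. }
  assert (Hynz : forall s, T < s -> y s <> 0%C).
  { intros s Hs E. destruct (HTy s Hs) as [_ [Q _]]. rewrite E, Cmod_0 in Q. lra. }
  assert (Hvnz : forall s, T < s -> v s <> 0%C).
  { intros s Hs E. apply (Hynz s Hs). unfold y. rewrite E. ring. }
  set (h := fun s => (d s * / v s)%C).
  assert (Hh : forall s, T < s -> is_cderive h s (- W s / (v s * v s))%C).
  { intros s Hs. assert (Hs0 : 0 < s) by lra. eapply is_cderive_value.
    - apply is_cderive_mult; [now apply Hd|]. apply is_cderive_inv; [now apply Hvnz|now apply Hv'].
    - unfold W. field. now apply Hvnz. }
  (* The power [b - 2a] turns [W / v^2] into [k / y^2], by Abel's identity and [y = s^a v]. *)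
  set (be := (b - a - a)%C).
  set (q := fun s => (h s * (Rcpow s be * RtoC (exp (- s))))%C).
  assert (Hq : forall s, T < s -> is_cderive q s (- k / (y s * y s) + q s * (be / RtoC s - 1))%C).
  { intros s Hs. assert (Hs0 : 0 < s) by lra. eapply is_cderive_value.
    - apply is_cderive_mult; [now apply Hh|]. apply is_cderive_mult; [now apply is_cderive_Rcpow|].
      apply is_cderive_RtoC. auto_derive; [trivial|reflexivity].
    - rewrite <- (HPk s Hs0). unfold P, q, y, h. rewrite Rcpow_minus1 by auto.
      replace (Rcpow s b) with (Rcpow s be * (Rcpow s a * Rcpow s a))%C
        by (rewrite <- !Rcpow_plus; f_equal; unfold be; ring).
      replace (- (1) * exp (- s)) with (- exp (- s)) by ring. rewrite RtoC_opp. field.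
      repeat split; auto using Rcpow_neq0. }
  (* [s^be e^(-s)] is bounded and [1 / |y| <= 2], so [q] inherits the limit 0 of [x]. *)
  destruct (ln1p_linear_bound (Rabs (Re be)) 1 Rlt_0_1) as [K0 HK0].
  assert (Hqx : forall s, T < s -> Cmod (q s) <= 2 * exp K0 * Cmod (x s)).
  { intros s Hs. assert (Hs0 : 0 < s) by lra. destruct (HTy s Hs) as [_ [Q _]].
    replace (q s) with (x s / y s * (Rcpow s be * RtoC (exp (- s))))%C.
    2:{ unfold q, h, x, y. field. split; auto using Rcpow_neq0. }
    rewrite !Cmod_mult, Cmod_div, Cmod_Rcpow, Cmod_R, Rabs_pos_eq by (auto; left; apply exp_pos).
    rewrite <- exp_plus.
    assert (exp (Re be * ln s + - s) <= exp K0).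
    { apply exp_le. pose proof (HK0 s Hs0).
      assert (0 <= ln s) by (rewrite <- ln_1; left; apply ln_increasing; lra).
      assert (ln s < ln (1 + s)) by (apply ln_increasing; lra).
      pose proof (Rle_abs (Re be)). pose proof (Rabs_pos (Re be)). nra. }
    pose proof (exp_pos (Re be * ln s + - s)). pose proof (Cmod_ge_0 (x s)).
    assert (Cmod (x s) / Cmod (y s) <= 2 * Cmod (x s)).
    { apply (Rmult_le_reg_r (Cmod (y s))); [lra|]. unfold Rdiv. rewrite Rmult_assoc, Rinv_l by lra. nra. }
    assert (0 <= Cmod (x s) / Cmod (y s)) by (apply Rdiv_le_0_compat; lra).
    replace (2 * exp K0 * Cmod (x s)) with (2 * Cmod (x s) * exp K0) by ring.
    apply Rmult_le_compat; lra. }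
  assert (Lq : is_climit q pinfty 0%C).
  { intros eps. pose proof (exp_pos K0).
    assert (He : 0 < eps / (2 * exp K0)) by (apply Rdiv_lt_0_compat; [apply cond_pos|lra]).
    eapply filter_imp; [|exact (filter_and _ _ (Lx (mkposreal _ He)) (ex_intro _ T (fun s Hs => Hs)))].
    intros s [Q1 Q2]; simpl in Q1, Q2. replace (q s - 0)%C with (q s) by ring.
    replace (x s - 0)%C with (x s) in Q1 by ring.
    eapply Rle_lt_trans; [now apply Hqx|].
    apply (Rmult_lt_compat_l (2 * exp K0)) in Q1; [|lra].
    replace (2 * exp K0 * (eps / (2 * exp K0))) with (pos eps) in Q1 by (field; lra). exact Q1. }
  assert (Hk0 : (- k)%C = 0%C).
  { apply (is_cderive_climit_0 q _ _ T Hq Lq).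
    (* [|1 / y^2 - 1| <= 10 |y - 1|], since [|y + 1| <= 5/2] and [|y| >= 1/2]; and
       [|be / s - 1| <= |be| + 1], since [s > 1]. *)
    intros eps. set (M := 10 * Cmod k + Cmod be + 1 + 1).
    assert (HM : 0 < M) by (unfold M; pose proof (Cmod_ge_0 k); pose proof (Cmod_ge_0 be); lra).
    assert (He : 0 < eps / M) by (apply Rdiv_lt_0_compat; [apply cond_pos|auto]).
    eapply filter_imp; [|exact (filter_and _ _ (filter_and _ _ (Lv (mkposreal _ He)) (Lq (mkposreal _ He)))
       (ex_intro _ T (fun s Hs => Hs)))].
    intros s [[Q1 Q2] Q3]; simpl in Q1, Q2, Q3. assert (Hs0 : 0 < s) by lra.
    replace (q s - 0)%C with (q s) in Q2 by ring. fold (y s) in Q1.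
    destruct (HTy s Q3) as [_ [Y1 Y2]].
    replace (- k / (y s * y s) + q s * (be / RtoC s - 1) - - k)%C
      with (k * ((y s - 1) * (y s + 1) / (y s * y s)) + q s * (be / RtoC s + - (1)))%C
      by (field; split; auto).
    eapply Rle_lt_trans; [apply Cmod_triangle|]. rewrite !Cmod_mult, Cmod_div, !Cmod_mult
      by (apply Cmult_neq_0; auto).
    assert (B1 : Cmod (be / RtoC s + - (1))%C <= Cmod be + 1).
    { eapply Rle_trans; [apply Cmod_triangle|].
      rewrite Cmod_opp, Cmod_1, Cmod_div, Cmod_R, Rabs_pos_eq by (auto; lra).
      apply Rplus_le_compat_r. apply (Rmult_le_reg_r s); [lra|].
      unfold Rdiv. rewrite Rmult_assoc, Rinv_l by lra. pose proof (Cmod_ge_0 be). nra. }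
    assert (B2 : Cmod (y s + 1)%C <= 5 / 2).
    { eapply Rle_trans; [apply Cmod_triangle|]. rewrite Cmod_1. lra. }
    assert (B3 : Cmod (y s - 1)%C * Cmod (y s + 1)%C / (Cmod (y s) * Cmod (y s)) <= 10 * Cmod (y s - 1)%C).
    { apply (Rmult_le_reg_r (Cmod (y s) * Cmod (y s))); [nra|].
      unfold Rdiv. rewrite Rmult_assoc, Rinv_l by nra. rewrite Rmult_1_r.
      pose proof (Cmod_ge_0 (y s - 1)%C). pose proof (Cmod_ge_0 (y s + 1)%C).
      assert (/ 4 <= Cmod (y s) * Cmod (y s)) by nra. nra. }
    pose proof (Cmod_ge_0 k). pose proof (Cmod_ge_0 (q s)). pose proof (Cmod_ge_0 be).
    pose proof (Cmod_ge_0 (be / RtoC s + - (1))%C). pose proof (Cmod_ge_0 (y s - 1)%C).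
    apply Rle_lt_trans with (Cmod k * (10 * Cmod (y s - 1)%C) + Cmod (q s) * (Cmod be + 1)).
    - apply Rplus_le_compat; apply Rmult_le_compat_l; auto.
    - apply Rle_lt_trans with ((10 * Cmod k + Cmod be + 1) * (eps / M)); [nra|].
      replace (pos eps) with (M * (eps / M)) at 2 by (field; lra).
      apply Rmult_lt_compat_r; [auto|]. unfold M. lra. }
  assert (HW : forall s, 0 < s -> W s = 0%C).
  { intros s Hs. assert (E : P s = 0%C).
    { rewrite HPk by auto. replace k with (- - k)%C by ring. rewrite Hk0. ring. }
    unfold P in E.
    replace (W s) with (Rcpow s b * (RtoC (exp (- s)) * W s) / (Rcpow s b * RtoC (exp (- s))))%C.
    - rewrite E. field. split; [apply RtoC_neq0, Rgt_not_eq, exp_pos | apply Rcpow_neq0].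
    - field. split; [apply RtoC_neq0, Rgt_not_eq, exp_pos | apply Rcpow_neq0]. }
  assert (Hd0 : forall s, T < s -> d s = 0%C).
  { intros s Hs. replace (d s) with (h s * v s)%C by (unfold h; field; now apply Hvnz).
    enough (E : h s = 0%C) by (rewrite E; ring).
    assert (Hc : forall u, T < u -> h u = h s).
    { intros u Hu. apply (is_cderive_0_const h T); auto. intros r Hr.
      eapply is_cderive_value; [now apply Hh|]. rewrite HW by lra.
      field. now apply Hvnz. }
    apply Cmod_eq_0. destruct (Rle_lt_or_eq_dec _ _ (Cmod_ge_0 (h s))) as [Q|Q]; [exfalso|now symmetry].
    assert (He : 0 < Cmod (h s) / 4) by lra.
    destruct (filter_ex (F := pinfty) _ (filter_and _ _ (Lx (mkposreal _ He))
      (ex_intro _ T (fun s Hs => Hs)))) as [u [Q1 Q2]]. simpl in Q1, Q2.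
    replace (x u - 0)%C with (x u) in Q1 by ring.
    destruct (HTy u Q2) as [_ [_ Y2]].
    assert (E : x u = (h u * y u)%C) by (unfold x, h, y; field; now apply Hvnz).
    destruct (HTy u Q2) as [_ [Y1 _]].
    rewrite E, Cmod_mult, (Hc u Q2) in Q1. nra. }
  assert (Hd10 : d1 (T + 1) = 0%C).
  { pose proof (HW (T + 1) ltac:(lra)) as E. unfold W in E. rewrite (Hd0 (T + 1)) in E by lra.
    replace (d1 (T + 1)) with (- (0 * v1 (T + 1)%R - d1 (T + 1)%R * v (T + 1)%R) / v (T + 1)%R)%C.
    - rewrite E. field. apply Hvnz; lra.
    - field. apply Hvnz; lra. }
  enough (E : d t = 0%C).
  { unfold d in E. transitivity (w t - v t + v t)%C; [ring|]. rewrite E. ring. }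
  (* Up to [T], where [v] may vanish, the equation is followed backwards from [T + 1]; there [d] and
     [d1] are 0, and on [t, T + 1] the division by [s >= t] keeps the coefficients bounded. *)
  destruct (Rlt_or_le T t) as [Q|Q]; [now apply Hd0|].
  apply (linear_ode2_backward_unique d d1 d2 (Cmod a / t) ((Cmod b + (T + 1)) / t) t (T + 1)); auto.
  - lra.
  - apply Rdiv_le_0_compat; [apply Cmod_ge_0|auto].
  - apply Rdiv_le_0_compat; [pose proof (Cmod_ge_0 b); lra|auto].
  - intros s Hs. assert (Hs0 : 0 < s) by lra. split; [now apply Hd|]. split; [now apply Hd1|].
    rewrite Ed2 by auto. rewrite Cmod_div, Cmod_R, Rabs_pos_eq by (auto; lra).
    apply Rle_trans with ((Cmod a * Cmod (d s) + (Cmod b + (T + 1)) * Cmod (d1 s)) / t).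
    2:{ right. field. lra. }
    apply Rmult_le_compat.
    + apply Cmod_ge_0.
    + left. now apply Rinv_0_lt_compat.
    + eapply Rle_trans; [apply Cmod_triangle|]. rewrite Cmod_opp, !Cmod_mult.
      apply Rplus_le_compat_l. apply Rmult_le_compat_r; [apply Cmod_ge_0|].
      eapply Rle_trans; [apply Cmod_triangle|]. rewrite Cmod_opp, Cmod_R, Rabs_pos_eq; lra.
    + apply Rinv_le_contravar; lra.
  - apply Hd0. lra.
Qed.

(** [tricomiU] is chosen by [epsilon]: the integral shows that the choice succeeds, and uniqueness
    that its outcome agrees with the integral for [t > 0]. *)
Lemma tricomiU_integral (a b : C) (t : R) : 0 < Re a -> 0 < t ->
  tricomiU a b t = (tricomi_integral a (b - a - 1) t / CGamma a)%C.
Proof.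
  intros Ha Ht.
  apply (is_tricomi_unique a b (tricomiU a b)
    (fun t => tricomi_integral a (b - a - 1) t / CGamma a)%C); auto.
  - unfold tricomiU. apply epsilon_spec. eexists. now apply is_tricomi_integral.
  - now apply is_tricomi_integral.
Qed.

(** * The incomplete Gamma function and the integral Whittaker function *)

(** [|ln t|] is controlled by [ln(1 + t)] for large [t] and by [|ln z0|] near the lower end, so [r]
    may have either sign. *)
Lemma pow_exp_bound (r z0 : R) : 0 < z0 ->
  exists K, 0 < K /\ forall t, z0 <= t -> exp (r * ln t) <= K * exp (t / 2).
Proof.
  intros Hz0. destruct (ln1p_linear_bound (Rabs r) (/ 2) ltac:(lra)) as [K HK].
  exists (exp (K + Rabs r * Rabs (ln z0))). split; [apply exp_pos|].
  intros t Ht. rewrite <- exp_plus. apply exp_le. pose proof (HK t ltac:(lra)).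
  assert (Hl : Rabs (ln t) <= ln (1 + t) + Rabs (ln z0)).
  { pose proof (ln1p_ge0 t ltac:(lra)). assert (ln t < ln (1 + t)) by (apply ln_increasing; lra).
    assert (ln z0 <= ln t) by (apply ln_le; lra).
    unfold Rabs. repeat destruct Rcase_abs; lra. }
  assert (r * ln t <= Rabs r * Rabs (ln t)) by (rewrite <- Rabs_mult; apply Rle_abs).
  pose proof (Rabs_pos r). nra.
Qed.

Lemma is_climit_at_point (F : R -> C) (z : R) : is_climit F (at_point z) (F z).
Proof.
  intros eps. unfold at_point. replace (F z - F z)%C with (RtoC 0) by ring. rewrite Cmod_0.
  apply cond_pos.
Qed.

Lemma is_climit_exp_decay (F : R -> C) (K c m : R) : 0 < c -> 0 <= K ->
  (forall s, m < s -> 0 < s -> Cmod (F s) <= K * exp (- (c * s))) -> is_climit F pinfty 0%C.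
Proof.
  intros Hc HK H. apply (is_climit_pinfty _ _ (K / c) m). intros s Hm Hs.
  replace (F s - 0)%C with (F s) by ring. eapply Rle_trans; [now apply H|].
  unfold Rdiv. rewrite Rmult_assoc. apply Rmult_le_compat_l; [lra|].
  rewrite <- Rinv_mult, exp_Ropp. apply Rinv_le_contravar; [nra|].
  pose proof (exp_ineq1_le (c * s)). lra.
Qed.

Lemma is_RInt_gen_exp_point (c z : R) : 0 < c -> 0 < z ->
  is_RInt_gen (fun s => exp (- (c * s))) (at_point z) pinfty (/ c * exp (- (c * z))).
Proof.
  intros Hc Hz. set (F := fun s => RtoC (- / c * exp (- (c * s)))).
  destruct (is_CInt_gen_derive (at_point z) F
    (fun s => RtoC (exp (- (c * s)))) (F z) 0%C) as [H _].
  - apply starts_in_point. intros t Ht; lra.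
  - intros t Ht. apply is_cderive_RtoC. auto_derive; [trivial|]. field. lra.
  - intros t Ht. apply ccontinuous_RtoC. apply (ex_derive_continuous (V := R_NormedModule)).
    auto_derive. trivial.
  - apply is_climit_at_point.
  - assert (Hic : 0 < / c) by now apply Rinv_0_lt_compat.
    apply (is_climit_exp_decay _ (/ c) c 0 Hc); [lra|]. intros s _ Hs.
    pose proof (exp_pos (- (c * s))). unfold F.
    rewrite Cmod_R, Ropp_mult_distr_l_reverse, Rabs_Ropp, Rabs_pos_eq by nra. lra.
  - replace (/ c * exp (- (c * z))) with (Re (0 - F z)%C) by (unfold F; simpl; ring). exact H.
Qed.

Lemma ccontinuous_Gamma_integrand (nu : C) (t : R) : 0 < t ->
  ccontinuous (fun t => Rcpow t (nu - 1) * RtoC (exp (- t)))%C t.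
Proof.
  intros Ht. apply ccontinuous_mult; [now apply ccontinuous_Rcpow|]. apply ccontinuous_RtoC.
  apply (ex_derive_continuous (V := R_NormedModule)). auto_derive. trivial.
Qed.

Lemma Gamma_integrand_bound (nu : C) (z0 : R) : 0 < z0 -> exists K, 0 < K /\
  forall t, z0 <= t -> Cmod (Rcpow t (nu - 1) * RtoC (exp (- t)))%C <= K * exp (- (/ 2 * t)).
Proof.
  intros Hz0. destruct (pow_exp_bound (Re (nu - 1)%C) z0 Hz0) as [K [HK H]].
  exists K. split; [auto|]. intros t Ht.
  rewrite Cmod_mult, Cmod_Rcpow, Cmod_R, Rabs_pos_eq by (left; apply exp_pos).
  replace (- (/ 2 * t)) with (t / 2 + - t) by field. rewrite exp_plus, <- Rmult_assoc.
  apply Rmult_le_compat_r; [left; apply exp_pos|auto].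
Qed.

Lemma inc_Gamma_integral (nu : C) (z : R) : 0 < z ->
  is_CInt_gen (fun t => Rcpow t (nu - 1) * RtoC (exp (- t)))%C (at_point z) pinfty (inc_Gamma nu z).
Proof.
  intros Hz. destruct (Gamma_integrand_bound nu z Hz) as [K [_ H]].
  apply (is_CInt_gen_dominated (at_point z) (fun t => z <= t) _ (fun t => K * exp (- (/ 2 * t)))).
  - now apply starts_in_point.
  - intros t Ht. apply ccontinuous_Gamma_integrand. lra.
  - exact H.
  - assert (H2 : 0 < / 2) by lra.
    eexists. apply (is_RInt_gen_scal _ K _ (is_RInt_gen_exp_point (/ 2) z H2 Hz)).
Qed.

Lemma inc_Gamma_bound (nu : C) (z0 : R) : 0 < z0 -> exists K, 0 < K /\
  forall z, z0 <= z -> Cmod (inc_Gamma nu z) <= K * exp (- (/ 2 * z)).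
Proof.
  intros Hz0. destruct (Gamma_integrand_bound nu z0 Hz0) as [K [HK H]].
  exists (4 * K). split; [lra|]. intros z Hz.
  replace (4 * K * exp (- (/ 2 * z))) with (2 * (K * (/ / 2 * exp (- (/ 2 * z))))) by field.
  apply (is_CInt_gen_Cmod_le (at_point z) (fun t => z <= t)
    (fun t => Rcpow t (nu - 1) * RtoC (exp (- t)))%C (fun t => K * exp (- (/ 2 * t)))).
  - now apply starts_in_point.
  - intros t Ht. apply H. lra.
  - apply inc_Gamma_integral. lra.
  - assert (H2 : 0 < / 2) by lra. assert (Hz' : 0 < z) by lra.
    apply (is_RInt_gen_scal _ K _ (is_RInt_gen_exp_point (/ 2) z H2 Hz')).
Qed.

Lemma is_cderive_inc_Gamma (nu : C) (z : R) : 0 < z ->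
  is_cderive (inc_Gamma nu) z (- (Rcpow z (nu - 1) * RtoC (exp (- z))))%C.
Proof.
  intros Hz.
  assert (K : forall (f : R -> R), (forall t, 0 < t -> continuous f t) ->
    (forall t, 0 < t -> is_RInt_gen f (at_point t) pinfty (RInt_gen f (at_point t) pinfty)) ->
    is_derive (fun t => RInt_gen f (at_point t) pinfty) z (- f z)).
  { intros f Hc Hf.
    assert (Hex : forall y, 0 < y -> is_RInt f y 1 (RInt f y 1)).
    { intros y Hy. apply (RInt_correct (V := R_CompleteNormedModule)).
      apply (ex_RInt_continuous (V := R_CompleteNormedModule)).
      intros s Hs. apply Hc. assert (0 < Rmin y 1) by (apply Rmin_case; lra). lra. }
    (* Only the proper integral from [y] to 1 varies; the tail from 1 is a constant. *)
    apply (is_derive_ext_loc (fun y => RInt f y 1 + RInt_gen f (at_point 1) pinfty)).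
    - eapply filter_imp; [|exact (locally_pos z Hz)]. intros y Hy.
      symmetry. apply (is_RInt_gen_unique (V := R_CompleteNormedModule)).
      apply (is_RInt_gen_Chasles f 1); [|apply Hf; lra].
      apply is_RInt_gen_at_point. now apply Hex.
    - eapply is_derive_value.
      + apply (is_derive_plus (fun y => RInt f y 1) (fun _ => RInt_gen f (at_point 1) pinfty)).
        * apply (is_derive_RInt' f (fun y => RInt f y 1) z 1); [|now apply Hc].
          eapply filter_imp; [|exact (locally_pos z Hz)]. intros y Hy. now apply Hex.
        * apply (is_derive_const (V := R_NormedModule)).
      + unfold plus, opp, zero; simpl. ring. }
  split.
  - apply (K (fun t => Re (Rcpow t (nu - 1) * RtoC (exp (- t)))%C)).
    + intros t Ht. apply (ccontinuous_Gamma_integrand nu t Ht).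
    + intros t Ht. apply (inc_Gamma_integral nu t Ht).
  - apply (K (fun t => Im (Rcpow t (nu - 1) * RtoC (exp (- t)))%C)).
    + intros t Ht. apply (ccontinuous_Gamma_integrand nu t Ht).
    + intros t Ht. apply (inc_Gamma_integral nu t Ht).
Qed.

(* [int_x^oo e^(-t (s + 1/2)) t^(nu - 1) dt] *)
Definition shifted_inc_Gamma (nu : C) (x s : R) : C :=
  (inc_Gamma nu (x * (s + / 2)) / Rcpow (/ 2 + s) nu)%C.

(** The powers of [s + 1/2] cancel, which leaves the exponential [e^(-x s)] of the Tricomi integral
    up to factors free of [s]. *)
Lemma is_cderive_shifted_inc_Gamma_l (nu : C) (x s : R) : 0 < x -> 0 < s ->
  is_cderive (fun x => shifted_inc_Gamma nu x s) x
    (- (1) * (Rcpow x (nu - 1) * RtoC (exp (- (x * (s + / 2))))))%C.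
Proof.
  intros Hx Hs. assert (Hxs : 0 < x * (s + / 2)) by (apply Rmult_lt_0_compat; lra).
  eapply is_cderive_value.
  - apply is_cderive_mult; [|apply is_cderive_const].
    apply (is_cderive_comp (inc_Gamma nu) (fun x => x * (s + / 2))).
    + now apply is_cderive_inc_Gamma.
    + auto_derive; [trivial|reflexivity].
  - rewrite Rmult_1_l, Rcpow_mult_base by lra. rewrite (Rplus_comm (/ 2) s).
    rewrite (Rcpow_minus1 (s + / 2)) by lra.
    field. split; [apply Rcpow_neq0 | apply RtoC_neq0; lra].
Qed.

Lemma ccontinuous_shifted_inc_Gamma (nu : C) (x s : R) : 0 < x -> 0 < s ->
  ccontinuous (shifted_inc_Gamma nu x) s.
Proof.
  intros Hx Hs. assert (Hxs : 0 < x * (s + / 2)) by (apply Rmult_lt_0_compat; lra).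
  apply ccontinuous_mult.
  - eapply is_cderive_continuous. apply (is_cderive_comp (inc_Gamma nu) (fun s => x * (s + / 2))).
    + now apply is_cderive_inc_Gamma.
    + auto_derive; [trivial|reflexivity].
  - eapply is_cderive_continuous. apply is_cderive_inv; [apply Rcpow_neq0|].
    apply (is_cderive_comp (fun u => Rcpow u nu) (fun s => / 2 + s)).
    + apply is_cderive_Rcpow. lra.
    + auto_derive; [trivial|reflexivity].
Qed.

(** Half of the exponent [x (s + 1/2)] is kept, and it is at least [x / 4 + x0 s / 2]. The decay in
    [s] gives integrability uniformly in [x], the decay in [x] gives the limit at +oo. *)
Lemma shifted_inc_Gamma_bound (nu : C) (x0 : R) : 0 < x0 -> exists K, 0 < K /\
  forall x s, x0 <= x -> 0 < s -> Cmod (shifted_inc_Gamma nu x s) <=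
    K * exp (- (/ 4 * x)) * exp (Rabs (Re nu) * ln (1 + s) - x0 / 2 * s).
Proof.
  intros Hx0. destruct (inc_Gamma_bound nu (x0 / 2) ltac:(lra)) as [K [HK H]].
  exists (K * exp (Rabs (Re nu) * ln 2)).
  split; [apply Rmult_lt_0_compat; [auto|apply exp_pos]|].
  intros x s Hx Hs. unfold shifted_inc_Gamma.
  rewrite Cmod_div, Cmod_Rcpow by apply Rcpow_neq0.
  unfold Rdiv at 1. rewrite <- exp_Ropp.
  replace (K * exp (Rabs (Re nu) * ln 2) * exp (- (/ 4 * x)) * exp (Rabs (Re nu) * ln (1 + s) - x0 / 2 * s))
   with (K * exp (- (/ 4 * x) - x0 / 2 * s) * exp (Rabs (Re nu) * (ln 2 + ln (1 + s)))).
  2:{ rewrite !Rmult_assoc, <- !exp_plus. f_equal. f_equal. ring. }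
  apply Rmult_le_compat.
  - apply Cmod_ge_0.
  - left; apply exp_pos.
  - eapply Rle_trans; [apply H; nra|]. apply Rmult_le_compat_l; [lra|]. apply exp_le. nra.
  - apply exp_le. assert (Hl : Rabs (ln (/ 2 + s)) <= ln 2 + ln (1 + s)).
    { pose proof (ln1p_ge0 s Hs).
      assert (ln (/ 2 + s) < ln (1 + s)) by (apply ln_increasing; lra).
      assert (ln (/ 2) < ln (/ 2 + s)) by (apply ln_increasing; lra).
      rewrite ln_Rinv in * by lra.
      assert (0 < ln 2) by (rewrite <- ln_1; apply ln_increasing; lra).
      unfold Rabs. destruct Rcase_abs; lra. }
    assert (- (Re nu * ln (/ 2 + s)) <= Rabs (Re nu) * Rabs (ln (/ 2 + s)))
      by (rewrite <- Rabs_mult, <- Rabs_Ropp; apply Rle_abs).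
    pose proof (Rabs_pos (Re nu)). nra.
Qed.

(** * The integral that represents [Gamma(a) wi], as a function of [x] *)

Definition wi_integral (a c nu : C) (x : R) : C :=
  CInt_gen (fun s => Rcpow s (a - 1) * Rcpow (1 + s) c * shifted_inc_Gamma nu x s)%C right0 pinfty.

Lemma wi_integral_correct (a c nu : C) (x : R) : 0 < Re a -> 0 < x ->
  is_CInt_gen (fun s => Rcpow s (a - 1) * Rcpow (1 + s) c * shifted_inc_Gamma nu x s)%C
    right0 pinfty (wi_integral a c nu x).
Proof.
  intros Ha Hx. destruct (shifted_inc_Gamma_bound nu x Hx) as [K [HK H]].
  apply (is_CInt_gen_gamma_kernel _ (K * exp (- (/ 4 * x))) (Re a) (Re c + Rabs (Re nu)) (x / 2)); auto.
  - lra.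
  - intros s Hs. apply ccontinuous_mult; [apply ccontinuous_mult|].
    + now apply ccontinuous_Rcpow.
    + now apply ccontinuous_Rcpow_1plus.
    + now apply ccontinuous_shifted_inc_Gamma.
  - intros s Hs. rewrite Cmod_mult, Cmod_beta_kernel.
    eapply Rle_trans; [apply Rmult_le_compat_l; [left; apply exp_pos | apply (H x s); [lra|auto]]|].
    unfold gamma_kernel. rewrite <- (Rmult_comm (exp (_ - _))), <- Rmult_assoc, <- exp_plus.
    rewrite Rmult_comm. right. f_equal. f_equal. ring.
Qed.

Lemma wi_integral_bound (a c nu : C) (x0 : R) : 0 < Re a -> 0 < x0 -> exists K, 0 <= K /\
  forall x, x0 <= x -> Cmod (wi_integral a c nu x) <= K * exp (- (/ 4 * x)).
Proof.
  intros Ha Hx0. destruct (shifted_inc_Gamma_bound nu x0 Hx0) as [K [HK H]].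
  destruct (ex_RInt_gen_gamma_kernel (Re a) (Re c + Rabs (Re nu)) (x0 / 2) Ha ltac:(lra)) as [I HI].
  exists (Rabs (2 * (K * I))). split; [apply Rabs_pos|].
  intros x Hx.
  apply Rle_trans with (2 * (K * exp (- (/ 4 * x)) * I)).
  2:{ pose proof (Rle_abs (2 * (K * I))). pose proof (exp_pos (- (/ 4 * x))). nra. }
  apply (is_CInt_gen_Cmod_le right0 (fun s => 0 < s)
     (fun s => Rcpow s (a - 1) * Rcpow (1 + s) c * shifted_inc_Gamma nu x s)%C
     (fun s => K * exp (- (/ 4 * x)) * gamma_kernel (Re a) (Re c + Rabs (Re nu)) (x0 / 2) s)).
  - apply starts_in_right0.
  - intros s Hs. rewrite Cmod_mult, Cmod_beta_kernel.
    eapply Rle_trans; [apply Rmult_le_compat_l; [left; apply exp_pos | apply (H x s); auto]|].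
    unfold gamma_kernel. rewrite <- (Rmult_comm (exp (_ - _))), <- Rmult_assoc, <- exp_plus.
    rewrite Rmult_comm. right. f_equal. f_equal. ring.
  - apply wi_integral_correct; lra.
  - apply (is_RInt_gen_scal _ (K * exp (- (/ 4 * x))) _ HI).
Qed.

(** Here the variable does not enter through a factor [e^(z L(s))], so Taylor's bound is applied for
    each [s] and then integrated. The second derivative is bounded uniformly for
    [|y - x| <= x / 2]. *)
Lemma is_cderive_wi_integral (a c nu : C) (x : R) : 0 < Re a -> 0 < x ->
  is_cderive (wi_integral a c nu) x
    (- (RtoC (exp (- x / 2)) * Rcpow x (nu - 1) * tricomi_integral a c x))%C.
Proof.
  intros Ha Hx.
  destruct (pow_exp_bound (Re (nu - 1)%C) (x / 2) ltac:(lra)) as [K1 [HK1 H1]].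
  destruct (pow_exp_bound (Re (nu - 1 - 1)%C) (x / 2) ltac:(lra)) as [K2 [HK2 H2]].
  (* [e^x] bounds [e^(y/2)] for [y <= 2x], so [K3 (1 + s) e^(-x s / 2)] bounds the second
     derivative. Its factor [1 + s] is the extra power in the kernel [Re c + 1]. *)
  set (K3 := (Cmod (nu - 1)%C * K2 + K1) * exp x).
  assert (HK3 : 0 <= K3).
  { unfold K3. pose proof (Cmod_ge_0 (nu - 1)%C). pose proof (exp_pos x).
    apply Rmult_le_pos; [nra|lra]. }
  destruct (ex_RInt_gen_gamma_kernel (Re a) (Re c + 1) (x / 2) Ha ltac:(lra)) as [I HI].
  set (l := (- (RtoC (exp (- x / 2)) * Rcpow x (nu - 1) * tricomi_integral a c x))%C).
  apply (quadratic_is_cderive _ _ l (x / 2) (2 * (2 * K3 * I))); [lra|].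
  intros h Hh.
  set (f1 := fun y s => (- (1) * (Rcpow y (nu - 1) * RtoC (exp (- (y * (s + / 2))))))%C).
  set (f2 := fun y s => (- (1) * ((nu - 1) * Rcpow y (nu - 1 - 1) * RtoC (exp (- (y * (s + / 2))))
     + Rcpow y (nu - 1) * RtoC (- (s + / 2) * exp (- (y * (s + / 2))))))%C).
  assert (HT : forall s, 0 < s ->
     Cmod (shifted_inc_Gamma nu (x + h) s - shifted_inc_Gamma nu x s - RtoC h * f1 x s)%C
     <= 2 * (K3 * exp (ln (1 + s) - x / 2 * s)) * (h * h)).
  { intros s Hs. apply (is_cderive_taylor2 (fun y => shifted_inc_Gamma nu y s)
      (fun y => f1 y s) (fun y => f2 y s)).
    intros y Hy.
    assert (Hy2 : x / 2 <= y <= 2 * x).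
    { assert (Rabs (y - x) <= x / 2) by lra. revert H. unfold Rabs; destruct Rcase_abs; lra. }
    split; [apply is_cderive_shifted_inc_Gamma_l; lra|]. split.
    - apply is_cderive_scal.
      apply (is_cderive_mult (fun y => Rcpow y (nu - 1)) (fun y => RtoC (exp (- (y * (s + / 2)))))).
      + apply is_cderive_Rcpow. lra.
      + apply is_cderive_RtoC. auto_derive; [trivial|ring].
    - unfold f2. rewrite Cmod_mult, Cmod_opp, Cmod_1, Rmult_1_l.
      eapply Rle_trans; [apply Cmod_triangle|].
      rewrite !Cmod_mult, !Cmod_Rcpow, !Cmod_R, Rabs_mult, Rabs_Ropp.
      rewrite (Rabs_pos_eq (exp _)), (Rabs_pos_eq (s + / 2)) by (try lra; left; apply exp_pos).
      assert (He : exp (- (y * (s + / 2))) <= exp (- (x / 2 * s))) by (apply exp_le; nra).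
      assert (Hey : exp (y / 2) <= exp x) by (apply exp_le; lra).
      specialize (H1 y ltac:(lra)). specialize (H2 y ltac:(lra)).
      set (E1 := exp (Re (nu - 1)%C * ln y)) in *. set (E2 := exp (Re (nu - 1 - 1)%C * ln y)) in *.
      assert (HE1 : 0 < E1) by apply exp_pos. assert (HE2 : 0 < E2) by apply exp_pos.
      pose proof (exp_pos (y / 2)). pose proof (exp_pos (- (y * (s + / 2)))). pose proof (exp_pos x).
      assert (B1 : E1 <= K1 * exp x) by nra. assert (B2 : E2 <= K2 * exp x) by nra.
      pose proof (Cmod_ge_0 (nu - 1)%C) as Hn. set (n := Cmod (nu - 1)%C) in *.
      replace (K3 * exp (ln (1 + s) - x / 2 * s)) with (K3 * (1 + s) * exp (- (x / 2 * s))).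
      2:{ unfold Rminus. rewrite exp_plus, exp_ln by lra. ring. }
      replace (n * E2 * exp (- (y * (s + / 2))) + E1 * ((s + / 2) * exp (- (y * (s + / 2)))))
        with ((n * E2 + E1 * (s + / 2)) * exp (- (y * (s + / 2)))) by ring.
      apply Rmult_le_compat; [|lra| |exact He].
      + apply Rplus_le_le_0_compat; apply Rmult_le_pos; lra.
      + unfold K3. fold n.
        assert (C1 : n * E2 <= n * (K2 * exp x)) by (apply Rmult_le_compat_l; auto).
        assert (C2 : E1 * (s + / 2) <= K1 * exp x * (1 + s)) by (apply Rmult_le_compat; lra).
        assert (0 <= n * (K2 * exp x) * s) by (repeat apply Rmult_le_pos; lra). nra. }
  (* The weighted derivative is the integrand of [tricomi_integral] up to a factor free of [s]. *)
  assert (Hl : is_CInt_gen (fun s => Rcpow s (a - 1) * Rcpow (1 + s) c * f1 x s)%C right0 pinfty l).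
  { unfold l.
    replace (- (RtoC (exp (- x / 2)) * Rcpow x (nu - 1) * tricomi_integral a c x))%C
     with ((- (RtoC (exp (- x / 2)) * Rcpow x (nu - 1))) * tricomi_integral a c x)%C by ring.
    eapply (is_CInt_gen_ext right0 (fun s => 0 < s)); [apply starts_in_right0| |
      exact (is_CInt_gen_scal right0 pinfty _ _ _ (tricomi_integral_correct a c x Ha Hx))].
    intros s Hs. unfold f1. cbv beta.
    replace (exp (- (x * (s + / 2)))) with (exp (- x / 2) * exp (- (x * s)))
      by (rewrite <- exp_plus; f_equal; field).
    rewrite RtoC_mult. ring. }
  replace (2 * (2 * K3 * I) * (h * h)) with (2 * (2 * K3 * (h * h) * I)) by ring.
  assert (Hxh : 0 < x + h) by (revert Hh; unfold Rabs; destruct Rcase_abs; lra).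
  apply (is_CInt_gen_Cmod_le right0 (fun s => 0 < s)
    (fun s => Rcpow s (a - 1) * Rcpow (1 + s) c * shifted_inc_Gamma nu (x + h) s
      - Rcpow s (a - 1) * Rcpow (1 + s) c * shifted_inc_Gamma nu x s
      - RtoC h * (Rcpow s (a - 1) * Rcpow (1 + s) c * f1 x s))%C
    (fun s => 2 * K3 * (h * h) * gamma_kernel (Re a) (Re c + 1) (x / 2) s)).
  - apply starts_in_right0.
  - intros s Hs.
    replace (_ - _ - _)%C with (Rcpow s (a - 1) * Rcpow (1 + s) c *
      (shifted_inc_Gamma nu (x + h) s - shifted_inc_Gamma nu x s - RtoC h * f1 x s))%C by ring.
    rewrite Cmod_mult, Cmod_beta_kernel.
    eapply Rle_trans; [apply Rmult_le_compat_l; [left; apply exp_pos | now apply HT]|].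
    unfold gamma_kernel.
    replace ((Re a - 1) * ln s + (Re c + 1) * ln (1 + s) - x / 2 * s)
      with (((Re a - 1) * ln s + Re c * ln (1 + s)) + (ln (1 + s) - x / 2 * s)) by ring.
    rewrite (exp_plus (_ + _)). right. ring.
  - apply (is_CInt_gen_minus right0 pinfty); [apply (is_CInt_gen_minus right0 pinfty)|].
    + now apply wi_integral_correct.
    + now apply wi_integral_correct.
    + now apply (is_CInt_gen_scal right0 pinfty).
  - apply (is_RInt_gen_scal _ (2 * K3 * (h * h)) _ HI).
Qed.

Lemma wi_eq (kappa mu : C) (x : R) : 0 < x -> 0 < Re (/ 2 + mu - kappa)%C ->
  wi kappa mu x =
  (wi_integral (/ 2 + mu - kappa) (mu + kappa - / 2) (/ 2 + mu) x / CGamma (/ 2 + mu - kappa))%C.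
Proof.
  intros Hx Ha. set (a := (/ 2 + mu - kappa)%C) in *. set (c := (mu + kappa - / 2)%C).
  set (nu := (/ 2 + mu)%C).
  assert (HG := CGamma_neq0 a Ha).
  (* An antiderivative of the integrand of [wi] that vanishes at +oo, so that the integral is
     [- F x]. *)
  set (F := fun t => (- / CGamma a * wi_integral a c nu t)%C).
  set (f := fun t => (- / CGamma a *
    - (RtoC (exp (- t / 2)) * Rcpow t (nu - 1) * tricomi_integral a c t))%C).
  apply (is_CInt_gen_unique _ (at_point x) pinfty).
  apply (is_CInt_gen_ext (at_point x) (fun t => 0 < t) f).
  - apply starts_in_point. intros t Ht; lra.
  - intros t Ht. unfold f, whittakerW. fold a. rewrite tricomiU_integral by auto.
    replace (1 + 2 * mu - a - 1)%C with c by (unfold c, a; field; apply RtoC_neq0; lra).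
    replace (mu + / 2)%C with nu by (unfold nu; ring).
    rewrite (Rcpow_minus1 t nu) by auto. field. split; [auto | apply RtoC_neq0; lra].
  - replace (wi_integral a c nu x / CGamma a)%C with (0 - F x)%C by (unfold F; field; auto).
    destruct (wi_integral_bound a c nu x Ha Hx) as [K [HK H]].
    apply (is_CInt_gen_derive (at_point x) F f).
    + apply starts_in_point. intros t Ht; lra.
    + intros t Ht. apply is_cderive_scal. now apply is_cderive_wi_integral.
    + intros t Ht. apply ccontinuous_scal.
      eapply is_cderive_continuous.
      apply (is_cderive_ext
        (fun t => - (1) * (RtoC (exp (- t / 2)) * Rcpow t (nu - 1) * tricomi_integral a c t))%C);
        [intros s; ring|].
      apply is_cderive_scal. apply is_cderive_mult; [apply is_cderive_mult|].
      * apply is_cderive_RtoC. auto_derive; [trivial|reflexivity].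
      * now apply is_cderive_Rcpow.
      * now apply is_cderive_tricomi_integral.
    + apply is_climit_at_point.
    + apply (is_climit_exp_decay F (Cmod (/ CGamma a)%C * K) (/ 4) x); [lra| |].
      * apply Rmult_le_pos; [apply Cmod_ge_0|auto].
      * intros s Hs _. unfold F. rewrite Cmod_mult, Cmod_opp, Rmult_assoc.
        apply Rmult_le_compat_l; [apply Cmod_ge_0|]. apply H. lra.
Qed.

(** * Differentiation in [kappa] *)

Lemma wi_integral_quadratic_derive (x : R) (kappa mu : C) :
  0 < x -> 0 < Re (/ 2 + mu - kappa)%C ->
  let f1 := fun s => (RtoC (ln ((1 + s) / s)) *
    (Rcpow s (/ 2 + mu - kappa - 1) * Rcpow (1 + s) (mu + kappa - / 2)
     * shifted_inc_Gamma (/ 2 + mu) x s))%C in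
  is_CInt_gen f1 right0 pinfty (CInt_gen f1 right0 pinfty) /\
  quadratic_derive (fun k => wi_integral (/ 2 + mu - k) (mu + k - / 2) (/ 2 + mu) x)
    kappa (CInt_gen f1 right0 pinfty).
Proof.
  intros Hx Ha f1. set (al := Re (/ 2 + mu - kappa)%C) in *.
  set (nu := (/ 2 + mu)%C) in *.
  destruct (shifted_inc_Gamma_bound nu x Hx) as [K [HK H]].
  (* [kappa] enters only through [((1 + s) / s)^kappa], and [B] is the integrand at [kappa = 0]. *)
  set (L := fun s => ln ((1 + s) / s)).
  set (B := fun s => (Rcpow s (nu - 1) * Rcpow (1 + s) (mu - / 2) * shifted_inc_Gamma nu x s)%C).
  assert (EL : forall s, 0 < s -> L s = ln (1 + s) - ln s).
  { intros s Hs. unfold L. apply ln_div; lra. }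
  assert (E : forall k s, 0 < s -> (Cexp (k * RtoC (L s)) * B s =
     Rcpow s (/ 2 + mu - k - 1) * Rcpow (1 + s) (mu + k - / 2) * shifted_inc_Gamma nu x s)%C).
  { intros k s Hs. rewrite EL by auto. unfold B. rewrite !Cmult_assoc. f_equal.
    unfold Rcpow. rewrite <- !Cexp_plus. f_equal. rewrite RtoC_minus. unfold nu. ring. }
  (* [L] is nonnegative, so the margin [(al / 2) L] moves [al / 2] from the exponent of [s] to that
     of [1 + s]; the kernel keeps [p = al / 2 > 0]. *)
  destruct (CInt_gen_quadratic_remainder L B kappa (al / 4) (K * exp (- (/ 4 * x))) (al / 2)
    (Re (mu + kappa - / 2)%C + al / 2 + Rabs (Re nu)) (x / 2)) as [H1 [H2 [M H3]]]; try lra.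
  - intros s Hs. apply (ex_derive_continuous (V := R_NormedModule)). unfold L. auto_derive.
    split; [lra|]. split; [|trivial]. apply Rdiv_lt_0_compat; lra.
  - intros s Hs. apply ccontinuous_mult; [apply ccontinuous_mult|].
    + now apply ccontinuous_Rcpow.
    + now apply ccontinuous_Rcpow_1plus.
    + now apply ccontinuous_shifted_inc_Gamma.
  - intros s Hs. assert (HL : 0 <= L s).
    { rewrite EL by auto. assert (ln s < ln (1 + s)) by (apply ln_increasing; lra). lra. }
    rewrite (Rabs_pos_eq (L s)) by auto. unfold B. rewrite Cmod_mult, Cmod_beta_kernel.
    eapply Rle_trans.
    { apply Rmult_le_compat_l; [left; apply exp_pos|].
      apply Rmult_le_compat_l; [left; apply exp_pos | apply (H x s); [lra|auto]]. }
    unfold gamma_kernel.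
    match goal with |- ?e1 * (?e2 * (?k * ?e3)) <= _ =>
      replace (e1 * (e2 * (k * e3))) with (k * (e1 * e2 * e3)) by ring end.
    rewrite <- !exp_plus. apply Rmult_le_compat_l; [pose proof (exp_pos (- (/ 4 * x))); nra|].
    apply exp_le. right. rewrite EL by auto.
    replace (Re nu) with (al + Re kappa) at 1 by (unfold al, nu; simpl; unfold Re; ring).
    replace (Re (mu + kappa - / 2)%C) with (Re (mu - / 2)%C + Re kappa) by (simpl; unfold Re; ring).
    field.
  - assert (E1 : forall k, Cmod (k - kappa)%C <= al / 4 ->
      CInt_gen (fun s => Cexp (k * RtoC (L s)) * B s)%C right0 pinfty =
      wi_integral (/ 2 + mu - k) (mu + k - / 2) nu x).
    { intros k Hk. symmetry. apply (is_CInt_gen_unique _ right0 pinfty).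
      eapply (is_CInt_gen_ext right0 (fun s => 0 < s)); [apply starts_in_right0| |exact (H1 k Hk)].
      intros s Hs. now apply E. }
    apply (is_CInt_gen_ext right0 (fun s => 0 < s) _ f1) in H2;
      [|apply starts_in_right0 | intros s Hs; rewrite E by auto; reflexivity].
    pose proof (is_CInt_gen_unique _ right0 pinfty _ H2) as E2. rewrite E2.
    split; [exact H2|].
    exists (al / 4), M. split; [lra|]. intros k Hk.
    rewrite <- !E1; [now apply H3 | | exact Hk].
    replace (kappa - kappa)%C with (RtoC 0) by ring. rewrite Cmod_0. lra.
Qed.

Theorem theorem38 (x : R) (kappa mu : C)
    (hx : 0 < x) (ha : 0 < Re (/ 2 + mu - kappa)%C) :
  let a : C := (/ 2 + mu - kappa)%C in
  let integrand : R -> C := fun t : R =>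
    ((digamma a + RtoC (ln ((1 + t) / t)))
     * (Rcpow t (mu - kappa - / 2) * Rcpow (1 + t) (mu + kappa - / 2)
        / Rcpow (/ 2 + t) (mu + / 2))
     * inc_Gamma (/ 2 + mu) (x * (t + / 2)))%C in
  ex_CInt_gen integrand (at_right 0) (Rbar_locally p_infty) /\
  is_derive (K := C_AbsRing) (V := C_NormedModule)
    (fun k : C => wi k mu x) kappa
    (/ CGamma a * CInt_gen integrand (at_right 0) (Rbar_locally p_infty))%C.
Proof.
  intros a integrand.
  destruct (wi_integral_quadratic_derive x kappa mu hx ha) as [HI1 HD]. fold a in HI1, HD.
  set (f1 := fun s : R => _) in HI1, HD.
  assert (HG := CGamma_neq0 a ha).
  set (N := wi_integral a (mu + kappa - / 2) (/ 2 + mu) x).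
  (* The integrand is [digamma a] times that of [wi_integral] plus [ln((1 + t) / t)] times the same
     function, and both integrals converge. *)
  assert (HI : is_CInt_gen integrand right0 pinfty (digamma a * N + CInt_gen f1 right0 pinfty)%C).
  { eapply (is_CInt_gen_ext right0 (fun s => 0 < s)); [apply starts_in_right0| |
      exact (is_CInt_gen_plus right0 pinfty _ _ _ _ (is_CInt_gen_scal right0 pinfty _ (digamma a) _
        (wi_integral_correct a (mu + kappa - / 2) (/ 2 + mu) x ha hx)) HI1)].
    intros s Hs. unfold f1, integrand, shifted_inc_Gamma.
    replace (mu - kappa - / 2)%C with (a - 1)%C by (unfold a; field; apply RtoC_neq0; lra).
    replace (mu + / 2)%C with (/ 2 + mu)%C by ring.
    field. apply Rcpow_neq0. }
  split; [exact (is_CInt_gen_ex integrand right0 pinfty _ HI)|].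
  rewrite (is_CInt_gen_unique integrand right0 pinfty _ HI).
  apply quadratic_derive_is_derive.
  (* The formula for [wi] must hold for all [k] near [kappa]: within distance [Re a / 2], the real
     part of [1/2 + mu - k] stays positive. *)
  apply (quadratic_derive_ext
    (fun k => wi_integral (/ 2 + mu - k) (mu + k - / 2) (/ 2 + mu) x / CGamma (/ 2 + mu - k))%C
    _ _ _ (Re a / 2)).
  - unfold a; lra.
  - intros k Hk. symmetry. apply wi_eq; [exact hx|].
    pose proof (re_le_Cmod (k - kappa)%C) as Hr. pose proof (Rle_abs (Re (k - kappa)%C)).
    replace (Re (/ 2 + mu - k)%C) with (Re a - Re (k - kappa)%C) by (unfold a; simpl; unfold Re; ring).
    fold a in ha. lra.
  (* The derivative of [k -> Gamma(1/2 + mu - k)] is [- Gamma'(a)], so the quotient rule contributes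
     [N Gamma'(a) / Gamma(a)^2], which is [digamma a] times [N / Gamma(a)]. *)
  - pose proof (quadratic_derive_div _ (fun k => CGamma (/ 2 + mu - k)%C) kappa _ _ HG HD
      (quadratic_derive_affine_comp CGamma (/ 2 + mu)%C kappa _ (CGamma_derive a ha))) as HQ.
    cbv beta in HQ. fold a N in HQ.
    replace (/ CGamma a * (digamma a * N + CInt_gen f1 right0 pinfty))%C
      with ((CInt_gen f1 right0 pinfty * CGamma a - N * - C_derive CGamma a) / (CGamma a * CGamma a))%C;
      [exact HQ|].
    unfold digamma. field. exact HG.
Qed.
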